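(* Let $Q$ be a finite quiver and let $\mathscr{C}$ be a finite, full, acyclic subcategory of $\downarrow\! Q$ such that every object of $\mathscr{C}$ is a connected quiver whose structure map is a wrapping, $\mathscr{C}$ is closed under fiber products, and for all objects $x,y$ of $\mathscr{C}$, the representation $L(x)$ is indecomposable in $\mathrm{rep}(Q)$ and $L(x)\not\simeq L(y)$ if $x\neq y$. Then the subring of $R(Q)$ generated by $L(\mathscr{C})=\{L(x): x\in\mathscr{C}\}$ is isomorphic to the Möbius ring $M(\mathscr{C})$ of $\mathscr{C}$.
   Context: Quivers are finite: $Q=(Q_0,Q_1,s,t)$. Fix a field $K$; $\mathrm{rep}(Q)$ is the category of finite dimensional representations of $Q$ over $K$. Representation ring: $R(Q)$ is the free abelian group on isomorphism classes $[V]$ of representations of $Q$, modulo the subgroup generated by all $[V\oplus W]-[V]-[W]$, with multiplication $[V][W]=[V\otimes W]$, where $\otimes$ is pointwise (tensor product of spaces at vertices and of maps over arrows). Rings are not required to have an identity: ''subring'' means a nonempty subset closed under subtraction and multiplication (possibly with a different identity element). Quivers over $Q$: a morphism of quivers sends vertices to vertices and arrows to arrows, compatibly with $s,t$. A quiver over $Q$ is a pair $(Q',f')$ with $f'\colon Q'\to Q$ a morphism of quivers (structure map); morphisms are morphisms of quivers commuting with structure maps. This category is $\downarrow\! Q$. Wrapping: $f'\colon Q'\to Q$ is a wrapping if for every pair $i',j'\in Q'_0$ the induced map from arrows $i'\to j'$ to arrows $f'(i')\to f'(j')$ is injective. Linearization: $L(Q',f')\in\mathrm{rep}(Q)$ has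 at $x\in Q_0$ the vector space with basis $\{b_v: v\in Q'_0,\ f'(v)=x\}$, and the map over $\alpha\in Q_1$ is $\sum_{\beta\in f'^{-1}(\alpha)}\varphi_\beta$, where $\varphi_\beta$ sends $b_{s(\beta)}$ to $b_{t(\beta)}$ and all other basis vectors to $0$. Fiber product: the categorical product in $\downarrow\! Q$; $(Q',f')\times_Q(Q'',f'')$ has vertices the pairs $(x',x'')$ with $f'(x')=f''(x'')$ and an arrow $(\alpha',\alpha'')\colon(x',x'')\to(y',y'')$ for each pair of arrows $\alpha'\colon x'\to y'$, $\alpha''\colon x''\to y''$ with $f'(\alpha')=f''(\alpha'')$. $\mathscr{C}$ is closed under fiber products if the fiber product of any two objects of $\mathscr{C}$ is isomorphic to a (possibly empty) disjoint union of objects of $\mathscr{C}$. Acyclic category: a small category whose only endomorphisms are identities and in which only identity morphisms are invertible. For a finite acyclic category $\mathscr{C}$ with object set $\mathscr{C}_0$, $[x,y]$ is the number of morphisms $x\to y$, and the Möbius function $\mu\colon\mathscr{C}_0\times\mathscr{C}_0\to\mathbb{Z}$ is the inverse matrix of $([x,y])_{x,y}$, i.e. $\sum_z[x,z]\mu(z,y)$ equals $1$ if $x=y$ and $0$ otherwise. Möbius ring: $M(\mathscr{C})$ has additive group free on $\mathscr{C}_0$. The elements $\delta_x=\sum_{z\in\mathscr{C}_0}\mu(z,x)z$ also form a $\mathbb{Z}$-basis, and multiplication is the $\mathbb{Z}$-bilinear one with $\delta_x\delta_x=\delta_x$ and $\delta_x\delta_y=0$ for $x\ne y$. *)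

(* Defs.v *)
From HB Require Import structures.
From mathcomp Require Import all_fingroup all_boot all_order all_algebra.
From mathcomp Require Import boolp classical_sets mxtens freeg.

Set Implicit Arguments.
Unset Strict Implicit.
Unset Printing Implicit Defensive.

Import GRing.Theory.

Local Open Scope ring_scope.
Local Open Scope quotient_scope.

Record quiver := Quiver {
  vert : finType;
  arrow : finType;
  src : arrow -> vert;
  tgt : arrow -> vert
}.

(* A subtype of a finite type, so that hom-sets can be counted. *)
Definition quiver_hom (P Q : quiver) :=
  {h : {ffun vert P -> vert Q} * {ffun arrow P -> arrow Q} |
    [forall a, (h.1 (src a) == src (h.2 a)) && (h.1 (tgt a) == tgt (h.2 a))]}.

HB.instance Definition _ P Q := Finite.on (quiver_hom P Q).

Definition hom_vert P Q (h : quiver_hom P Q) : vert P -> vert Q := (val h).1.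
Definition hom_arrow P Q (h : quiver_hom P Q) : arrow P -> arrow Q := (val h).2.

Lemma hom_src P Q (h : quiver_hom P Q) a :
  hom_vert h (src a) = src (hom_arrow h a).
Proof. by have /forallP/(_ a)/andP[/eqP] := valP h. Qed.

Lemma hom_tgt P Q (h : quiver_hom P Q) a :
  hom_vert h (tgt a) = tgt (hom_arrow h a).
Proof. by have /forallP/(_ a)/andP[_ /eqP] := valP h. Qed.

Lemma mk_quiver_hom_subproof (P Q : quiver)
    (fv : vert P -> vert Q) (fa : arrow P -> arrow Q)
    (hs : forall a, fv (src a) = src (fa a))
    (ht : forall a, fv (tgt a) = tgt (fa a)) :
  let h := (finfun fv, finfun fa) in
  [forall a, (h.1 (src a) == src (h.2 a)) && (h.1 (tgt a) == tgt (h.2 a))].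
Proof. by apply/forallP => a; rewrite /= !ffunE hs ht !eqxx. Qed.

Definition mk_quiver_hom P Q fv fa hs ht : quiver_hom P Q :=
  Sub (finfun fv, finfun fa) (@mk_quiver_hom_subproof P Q fv fa hs ht).

Lemma quiver_hom_ext P Q (g h : quiver_hom P Q) :
  hom_vert g =1 hom_vert h -> hom_arrow g =1 hom_arrow h -> g = h.
Proof.
move=> ev ea; apply: val_inj; rewrite [val g]surjective_pairing.
by rewrite [val h]surjective_pairing; congr (_, _); apply/ffunP.
Qed.

Definition quiver_id P : quiver_hom P P :=
  @mk_quiver_hom P P id id (fun=> erefl) (fun=> erefl).

Lemma quiver_comp_src P Q S (h : quiver_hom Q S) (g : quiver_hom P Q) a :
  hom_vert h (hom_vert g (src a)) = src (hom_arrow h (hom_arrow g a)).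
Proof. by rewrite !hom_src. Qed.

Lemma quiver_comp_tgt P Q S (h : quiver_hom Q S) (g : quiver_hom P Q) a :
  hom_vert h (hom_vert g (tgt a)) = tgt (hom_arrow h (hom_arrow g a)).
Proof. by rewrite !hom_tgt. Qed.

Definition quiver_comp P Q S (h : quiver_hom Q S) (g : quiver_hom P Q) :
    quiver_hom P S :=
  @mk_quiver_hom P S (fun v => hom_vert h (hom_vert g v))
    (fun a => hom_arrow h (hom_arrow g a))
    (quiver_comp_src h g) (quiver_comp_tgt h g).

Lemma mk_quiver_homE P Q fv fa hs ht :
  (hom_vert (@mk_quiver_hom P Q fv fa hs ht) =1 fv) *
  (hom_arrow (@mk_quiver_hom P Q fv fa hs ht) =1 fa).
Proof. by split=> z; rewrite /hom_vert /hom_arrow /= ffunE. Qed.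

Lemma quiver_comp1q P Q (h : quiver_hom P Q) : quiver_comp (quiver_id Q) h = h.
Proof. by apply: quiver_hom_ext => z; rewrite !mk_quiver_homE. Qed.

Lemma quiver_compq1 P Q (h : quiver_hom P Q) : quiver_comp h (quiver_id P) = h.
Proof. by apply: quiver_hom_ext => z; rewrite !mk_quiver_homE. Qed.

Lemma quiver_compA P Q S T (k : quiver_hom S T) (h : quiver_hom Q S)
    (g : quiver_hom P Q) :
  quiver_comp k (quiver_comp h g) = quiver_comp (quiver_comp k h) g.
Proof. by apply: quiver_hom_ext => z; rewrite !mk_quiver_homE. Qed.

Record quiver_over (Q : quiver) := Over {
  over_quiver :> quiver;
  structure_map : quiver_hom over_quiver Q
}.
Arguments structure_map {Q} X : rename.

Definition over_hom Q (X Y : quiver_over Q) :=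
  {g : quiver_hom X Y |
    quiver_comp (structure_map Y) g == structure_map X}.

HB.instance Definition _ Q (X Y : quiver_over Q) := Finite.on (over_hom X Y).

Lemma over_id_subproof Q (X : quiver_over Q) :
  quiver_comp (structure_map X) (quiver_id X) == structure_map X.
Proof. by rewrite quiver_compq1. Qed.

Definition over_id Q (X : quiver_over Q) : over_hom X X :=
  Sub (quiver_id X) (over_id_subproof X).

Lemma over_comp_subproof Q (X Y Z : quiver_over Q)
    (h : over_hom Y Z) (g : over_hom X Y) :
  quiver_comp (structure_map Z) (quiver_comp (val h) (val g))
    == structure_map X.
Proof. by rewrite quiver_compA (eqP (valP h)) (valP g). Qed.

Definition over_comp Q (X Y Z : quiver_over Q)
    (h : over_hom Y Z) (g : over_hom X Y) : over_hom X Z :=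
  Sub (quiver_comp (val h) (val g)) (over_comp_subproof h g).

Definition over_iso Q (X Y : quiver_over Q) : Prop :=
  exists (g : over_hom X Y) (h : over_hom Y X),
    over_comp h g = over_id X /\ over_comp g h = over_id Y.

Definition wrapping P Q (f : quiver_hom P Q) : Prop :=
  forall a b : arrow P, src a = src b -> tgt a = tgt b ->
    hom_arrow f a = hom_arrow f b -> a = b.

Definition adjacent (P : quiver) : rel (vert P) := fun u v =>
  [exists a : arrow P, ((src a == u) && (tgt a == v))
                    || ((src a == v) && (tgt a == u))].

(* The empty quiver is not connected. *)
Definition connected_quiver (P : quiver) : Prop :=
  (0 < #|vert P|)%N /\ forall u v : vert P, connect (@adjacent P) u v.

Section FiberProduct.
Variables (Q : quiver) (X Y : quiver_over Q).

Let fX := structure_map X.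
Let fY := structure_map Y.

Definition fiber_vert :=
  {p : vert X * vert Y | hom_vert fX p.1 == hom_vert fY p.2}.
Definition fiber_arrow :=
  {p : arrow X * arrow Y | hom_arrow fX p.1 == hom_arrow fY p.2}.

Lemma fiber_src_subproof (a : fiber_arrow) :
  hom_vert fX (src (val a).1) == hom_vert fY (src (val a).2).
Proof. by rewrite !hom_src (eqP (valP a)). Qed.

Lemma fiber_tgt_subproof (a : fiber_arrow) :
  hom_vert fX (tgt (val a).1) == hom_vert fY (tgt (val a).2).
Proof. by rewrite !hom_tgt (eqP (valP a)). Qed.

Definition fiber_quiver : quiver :=
  @Quiver fiber_vert fiber_arrow
    (fun a => Sub (src (val a).1, src (val a).2) (fiber_src_subproof a))
    (fun a => Sub (tgt (val a).1, tgt (val a).2) (fiber_tgt_subproof a)).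

Definition fiber_product : quiver_over Q :=
  @Over Q fiber_quiver
    (@mk_quiver_hom fiber_quiver Q
      (fun p => hom_vert fX (val p).1) (fun a => hom_arrow fX (val a).1)
      (fun a => hom_src fX (val a).1) (fun a => hom_tgt fX (val a).1)).

End FiberProduct.

Section DisjointUnion.
Variables (Q : quiver) (n : nat) (Y : 'I_n -> quiver_over Q).

Definition union_quiver : quiver :=
  @Quiver {i : 'I_n & vert (Y i)} {i : 'I_n & arrow (Y i)}
    (fun a => Tagged (fun i => vert (Y i)) (src (tagged a)))
    (fun a => Tagged (fun i => vert (Y i)) (tgt (tagged a))).

Definition disjoint_union : quiver_over Q :=
  @Over Q union_quiver
    (@mk_quiver_hom union_quiver Q
      (fun v => hom_vert (structure_map (Y (tag v))) (tagged v))
      (fun a => hom_arrow (structure_map (Y (tag a))) (tagged a))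
      (fun a => hom_src (structure_map (Y (tag a))) (tagged a))
      (fun a => hom_tgt (structure_map (Y (tag a))) (tagged a))).

End DisjointUnion.

Definition closed_under_fiber_products Q (I : Type)
    (X : I -> quiver_over Q) : Prop :=
  forall x y : I, exists (n : nat) (z : 'I_n -> I),
    over_iso (fiber_product (X x) (X y)) (disjoint_union (fun i => X (z i))).

Record fincat := FinCat {
  obj :> finType;
  mor : obj -> obj -> finType;
  id_mor : forall x, mor x x;
  comp_mor : forall x y z, mor y z -> mor x y -> mor x z;
  comp_mor1m : forall x y (f : mor x y), comp_mor (id_mor y) f = f;
  comp_morm1 : forall x y (f : mor x y), comp_mor f (id_mor x) = f;
  comp_morA : forall x y z t (h : mor z t) (g : mor y z) (f : mor x y),
    comp_mor h (comp_mor g f) = comp_mor (comp_mor h g) f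
}.
Arguments mor {C} x y : rename.
Arguments id_mor {C} x : rename.
Arguments comp_mor {C x y z} g f : rename.

Variant is_identity (C : fincat) : forall x y : C, mor x y -> Prop :=
  IsIdentity x : is_identity (id_mor x).

Definition invertible_mor (C : fincat) (x y : C) (f : mor x y) : Prop :=
  exists g : mor y x, comp_mor g f = id_mor x /\ comp_mor f g = id_mor y.

Definition acyclic (C : fincat) : Prop :=
  (forall (x : C) (f : mor x x), f = id_mor x) /\
  (forall (x y : C) (f : mor x y), invertible_mor f -> is_identity f).

Record acyclicCat := AcyclicCat {
  acyclic_cat :> fincat;
  acyclic_catP : acyclic acyclic_cat
}.

(* The full subcategory of the category of quivers over [Q] whose objects are
   the [X i], indexed by [I]. It is acyclic only if [X] is injective: for
   [X i = X j], the identity map is an invertible morphism from [i] to [j]. *)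
Section FullSubcat.
Variables (Q : quiver) (I : finType) (X : I -> quiver_over Q).

Let hom (x y : I) : finType := over_hom (X x) (X y).

Lemma over_comp1m (x y : I) (f : hom x y) : over_comp (over_id (X y)) f = f.
Proof. by apply: val_inj; rewrite /= quiver_comp1q. Qed.

Lemma over_compm1 (x y : I) (f : hom x y) : over_comp f (over_id (X x)) = f.
Proof. by apply: val_inj; rewrite /= quiver_compq1. Qed.

Lemma over_compA (x y z t : I) (h : hom z t) (g : hom y z) (f : hom x y) :
  over_comp h (over_comp g f) = over_comp (over_comp h g) f.
Proof. by apply: val_inj; rewrite /= quiver_compA. Qed.

Definition full_subcat : fincat :=
  @FinCat I hom (fun x => over_id (X x))
    (fun x y z (g : hom y z) (f : hom x y) => over_comp g f)
    over_comp1m over_compm1 over_compA.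

End FullSubcat.

Section MobiusFunction.
Variable C : fincat.

Definition hom_count (x y : C) : int := #|mor x y|%:Z.

Definition hom_matrix : 'M[int]_#|C| :=
  \matrix_(i, j) hom_count (enum_val i) (enum_val j).

Definition mobius (x y : C) : int :=
  invmx hom_matrix (enum_rank x) (enum_rank y).

End MobiusFunction.

Section MobiusRing.
Variable C : acyclicCat.
Implicit Types x y z : C.

Lemma mor_antisym x y (f : mor x y) (g : mor y x) : x = y.
Proof.
have [endo inv] := acyclic_catP C.
by case: (inv x y f) => //; exists g; split; apply: endo.
Qed.

Lemma hom_count_id x : hom_count x x = 1.
Proof.
have [endo _] := acyclic_catP C; rewrite /hom_count.
by rewrite (@eq_card1 _ (id_mor x)) // => f; rewrite !inE (endo _ f) eqxx.
Qed.

Lemma det_hom_matrix : \det (hom_matrix C) = 1.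
Proof.
rewrite /determinant (bigD1 (1%g : 'S_#|C|)) //= odd_perm1 expr0 mul1r.
rewrite big1 ?mul1r => [|i _]; last by rewrite mxE perm1 hom_count_id.
rewrite big1 ?addr0 // => s sN1.
apply/eqP; rewrite mulf_eq0; apply/orP; right.
apply: contraR sN1 => /prodf_neq0 neq0.
have step i : inhabited (mor (enum_val i) (enum_val (s i))).
  have := neq0 i isT; rewrite mxE /hom_count.
  by case: (pickP (mor (enum_val i) (enum_val (s i)))) => [f _|/eq_card0->].
have iter i k : inhabited (mor (enum_val i) (enum_val ((s ^+ k)%g i))).
  elim: k => [|k [f]]; first by rewrite perm1; exists; apply: id_mor.
  rewrite expgSr permM; have [g] := step ((s ^+ k)%g i).
  by exists; apply: comp_mor g f.
apply/eqP/perm.permP => i; rewrite perm1; apply: enum_val_inj.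
have [f] := step i; have [g] := iter (s i) #[s]%g.-1.
apply/esym/(mor_antisym f); move: g.
by rewrite -permM -expgS prednK ?order_gt0 // expg_order perm1.
Qed.

Lemma hom_matrix_unit : hom_matrix C \in unitmx.
Proof. by rewrite unitmxE det_hom_matrix unitr1. Qed.

Lemma hom_countK x y :
  \sum_(z : C) hom_count x z * mobius z y = (x == y)%:R.
Proof.
have /matrixP/(_ (enum_rank x) (enum_rank y)) := mulmxV hom_matrix_unit.
rewrite !mxE (inj_eq enum_rank_inj) => <-.
rewrite (reindex (@enum_rank C)) /=; last first.
  by exists enum_val => i _; rewrite (enum_valK, enum_rankK).
by apply: eq_bigr => z _; rewrite mxE !enum_rankK.
Qed.

Lemma mobiusK x y :
  \sum_(z : C) mobius x z * hom_count z y = (x == y)%:R.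
Proof.
have /matrixP/(_ (enum_rank x) (enum_rank y)) := mulVmx hom_matrix_unit.
rewrite !mxE (inj_eq enum_rank_inj) => <-.
rewrite (reindex (@enum_rank C)) /=; last first.
  by exists enum_val => i _; rewrite (enum_valK, enum_rankK).
by apply: eq_bigr => z _; rewrite mxE !enum_rankK.
Qed.

Definition mobius_ring : Type := {ffun C -> int}.

HB.instance Definition _ := GRing.Zmodule.on mobius_ring.

Definition mobius_basis (x : C) : mobius_ring := [ffun z => (z == x)%:R].

Definition mobius_delta (x : C) : mobius_ring :=
  \sum_(z : C) mobius_basis z *~ mobius z x.

(* The coordinate of [a] at [mobius_delta y]; see [mobius_deltaE]. *)
Definition mobius_coord (y : C) (a : mobius_ring) : int :=
  \sum_(x : C) hom_count y x * a x.

(* The bilinear product for which the [mobius_delta x] are orthogonal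
   idempotents; see [mobius_delta_mul]. *)
Definition mobius_mul (a b : mobius_ring) : mobius_ring :=
  \sum_(y : C) mobius_delta y *~ (mobius_coord y a * mobius_coord y b).

Definition mobius_one : mobius_ring := \sum_(y : C) mobius_delta y.

Lemma mobius_coord_is_additive y : zmod_morphism (mobius_coord y).
Proof.
move=> a b; rewrite /mobius_coord -sumrB; apply: eq_bigr => x _.
by rewrite !ffunE mulrBr.
Qed.

HB.instance Definition _ y :=
  GRing.isZmodMorphism.Build mobius_ring int (mobius_coord y)
    (mobius_coord_is_additive y).

Lemma mobius_coord_basis y x : mobius_coord y (mobius_basis x) = hom_count y x.
Proof.
rewrite /mobius_coord (bigD1 x) //= ffunE eqxx mulr1 big1 ?addr0 // => z zx.
by rewrite ffunE (negPf zx) mulr0.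
Qed.

Lemma mobius_coord_delta y x : mobius_coord y (mobius_delta x) = (y == x)%:R.
Proof.
rewrite /mobius_delta raddf_sum -hom_countK; apply: eq_bigr => z _.
by rewrite raddfMz /= mobius_coord_basis mulrzz.
Qed.

Lemma mobius_basis_delta x :
  mobius_basis x = \sum_(y : C) mobius_delta y *~ hom_count y x.
Proof.
transitivity (\sum_(z : C) mobius_basis z *~ (z == x)%:R).
  by rewrite (bigD1 x) //= eqxx big1 ?addr0 // => z /negPf->.
under [RHS]eq_bigr => y _ do rewrite /mobius_delta mulrz_suml.
rewrite exchange_big; apply: eq_bigr => z _ /=.
under [RHS]eq_bigr => y _ do rewrite -mulrzA.
by rewrite -mulrz_sumr mobiusK; case: eqP.
Qed.

Lemma mobius_basisE (a : mobius_ring) : a = \sum_(x : C) mobius_basis x *~ a x.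
Proof.
have evalMz (b : {ffun C -> int}) n x : (b *~ n) x = b x *~ n.
  by case: n => n; rewrite ?NegzE ?mulrNz -!pmulrn ?ffunE ffunMnE.
apply/ffunP => z; rewrite sum_ffunE (bigD1 z) //= evalMz ffunE eqxx intz.
rewrite big1 ?addr0 // => x xz.
by rewrite evalMz ffunE eq_sym (negPf xz) mul0rz.
Qed.

Lemma mobius_deltaE (a : mobius_ring) :
  a = \sum_(y : C) mobius_delta y *~ mobius_coord y a.
Proof.
rewrite {1}[a]mobius_basisE.
under eq_bigr => x _ do rewrite mobius_basis_delta mulrz_suml.
rewrite exchange_big; apply: eq_bigr => y _ /=.
under eq_bigr => x _ do rewrite -mulrzA.
by rewrite -mulrz_sumr.
Qed.

Lemma mobius_coord_inj (a b : mobius_ring) :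
  (forall y, mobius_coord y a = mobius_coord y b) -> a = b.
Proof.
move=> eq_ab; rewrite [a]mobius_deltaE [b]mobius_deltaE.
by apply: eq_bigr => y _; rewrite eq_ab.
Qed.

Lemma mobius_coord_sum y (F : C -> int) :
  mobius_coord y (\sum_(x : C) mobius_delta x *~ F x) = F y.
Proof.
rewrite raddf_sum (bigD1 y) //= raddfMz /= mobius_coord_delta eqxx intz.
rewrite big1 ?addr0 // => x xy.
by rewrite raddfMz /= mobius_coord_delta eq_sym (negPf xy) mul0rz.
Qed.

Lemma mobius_coord_mul y a b :
  mobius_coord y (mobius_mul a b) = mobius_coord y a * mobius_coord y b.
Proof. exact: mobius_coord_sum. Qed.

Lemma mobius_coord_one y : mobius_coord y mobius_one = 1.
Proof. exact: (mobius_coord_sum y (fun=> 1)). Qed.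

Lemma mobius_mulA : associative mobius_mul.
Proof.
by move=> a b c; apply: mobius_coord_inj => y; rewrite !mobius_coord_mul mulrA.
Qed.

Lemma mobius_mulC : commutative mobius_mul.
Proof.
by move=> a b; apply: mobius_coord_inj => y; rewrite !mobius_coord_mul mulrC.
Qed.

Lemma mobius_mul1 : left_id mobius_one mobius_mul.
Proof.
move=> a; apply: mobius_coord_inj => y.
by rewrite mobius_coord_mul mobius_coord_one mul1r.
Qed.

Lemma mobius_mulDl : left_distributive mobius_mul +%R.
Proof.
move=> a b c; apply: mobius_coord_inj => y.
by rewrite raddfD /= !mobius_coord_mul raddfD mulrDl.
Qed.

HB.instance Definition _ := GRing.Zmodule_isComPzRing.Build mobius_ring
  mobius_mulA mobius_mulC mobius_mul1 mobius_mulDl.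

Lemma mobius_delta_mul x y :
  mobius_delta x * mobius_delta y = if x == y then mobius_delta x else 0.
Proof.
apply: mobius_coord_inj => z; rewrite mobius_coord_mul !mobius_coord_delta.
case: (eqVneq x y) => [<-|xy]; last first.
  rewrite raddf0; case: (eqVneq z x) => [->|_]; last by rewrite mul0r.
  by rewrite (negPf xy) mulr0.
by rewrite mobius_coord_delta; case: eqP; rewrite ?mulr0 ?mulr1.
Qed.

End MobiusRing.

(* Representations are given in coordinates: the space at [x] is the space of
   row vectors ['rV[K]_(rdim V x)], and an arrow [a] acts on row vectors by
   right multiplication by [rmap V a]. Every finite dimensional representation
   is isomorphic to one of this form, by choosing bases. *)
Record rep (K : fieldType) (Q : quiver) := Rep {
  rdim : vert Q -> nat;
  rmap : forall a : arrow Q, 'M[K]_(rdim (src a), rdim (tgt a))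
}.

HB.instance Definition _ K Q := gen_eqMixin (rep K Q).
HB.instance Definition _ K Q := gen_choiceMixin (rep K Q).

Section Representations.
Variables (K : fieldType) (Q : quiver).
Implicit Types U V W : rep K Q.

Definition is_rep_hom V W (F : forall x, 'M[K]_(rdim V x, rdim W x)) : Prop :=
  forall a : arrow Q, rmap V a *m F (tgt a) = F (src a) *m rmap W a.
Arguments is_rep_hom V W F : clear implicits.

Definition rep_iso V W : Prop :=
  exists F G, [/\ is_rep_hom V W F, is_rep_hom W V G,
    forall x, F x *m G x = 1%:M & forall x, G x *m F x = 1%:M].

Definition zero_rep V : Prop := forall x, rdim V x = 0%N.

Definition dsum V W : rep K Q :=
  @Rep K Q (fun x => rdim V x + rdim W x)%N
    (fun a => block_mx (rmap V a) 0 0 (rmap W a)).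

Definition tens V W : rep K Q :=
  @Rep K Q (fun x => rdim V x * rdim W x)%N (fun a => rmap V a *t rmap W a).

Definition unit_rep : rep K Q := @Rep K Q (fun=> 1%N) (fun=> 1%:M).

Definition indecomposable V : Prop :=
  ~ zero_rep V /\
  forall U W, rep_iso V (dsum U W) -> zero_rep U \/ zero_rep W.

Lemma rep_iso_refl V : rep_iso V V.
Proof.
by exists (fun=> 1%:M), (fun=> 1%:M); split=> x; rewrite ?mulmx1 ?mul1mx.
Qed.

Lemma rep_iso_sym V W : rep_iso V W -> rep_iso W V.
Proof. by move=> [F [G [hF hG FG GF]]]; exists G, F; split. Qed.

Lemma rep_iso_trans U V W : rep_iso U V -> rep_iso V W -> rep_iso U W.
Proof.
move=> [F [G [hF hG FG GF]]] [F' [G' [hF' hG' FG' GF']]].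
exists (fun x => F x *m F' x), (fun x => G' x *m G x); split=> x.
- by rewrite mulmxA hF -!mulmxA hF'.
- by rewrite mulmxA hG' -!mulmxA hG.
- by rewrite mulmxA -(mulmxA (F x)) FG' mulmx1.
- by rewrite mulmxA -(mulmxA (G' x)) GF mulmx1.
Qed.

Lemma rep_iso_tens V V' W W' :
  rep_iso V V' -> rep_iso W W' -> rep_iso (tens V W) (tens V' W').
Proof.
have tens11 m n : (1%:M *t 1%:M : 'M[K]_(m * n)) = 1%:M.
  apply/matrixP => i j; case: (mxtens_indexP i) => i1 i2.
  case: (mxtens_indexP j) => j1 j2; rewrite tensmxE !mxE -natrM mulnb.
  by rewrite (can_eq (@mxtens_indexK _ _)) xpair_eqE.
move=> [F [G [hF hG FG GF]]] [F' [G' [hF' hG' FG' GF']]].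
exists (fun x => F x *t F' x), (fun x => G x *t G' x); split=> x /=.
- by rewrite !tensmx_mul hF hF'.
- by rewrite !tensmx_mul hG hG'.
- by rewrite tensmx_mul FG FG' tens11.
- by rewrite tensmx_mul GF GF' tens11.
Qed.

Lemma rep_iso_reindex V W
    (e : forall x, 'I_(rdim V x) -> 'I_(rdim W x))
    (e' : forall x, 'I_(rdim W x) -> 'I_(rdim V x)) :
  (forall x, cancel (@e x) (@e' x)) -> (forall x, cancel (@e' x) (@e x)) ->
  (forall a i j, rmap V a i j = rmap W a (e _ i) (e _ j)) ->
  rep_iso V W.
Proof.
move=> eK e'K eqVW.
pose F x : 'M[K]_(rdim V x, rdim W x) := \matrix_(i, j) (e x i == j)%:R.
pose G x : 'M[K]_(rdim W x, rdim V x) := \matrix_(i, j) (e' x i == j)%:R.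
have mulF x m (A : 'M[K]_(rdim W x, m)) i j : (F x *m A) i j = A (e x i) j.
  rewrite mxE (bigD1 (e x i)) //= mxE eqxx mul1r big1 ?addr0 // => k ki.
  by rewrite mxE eq_sym (negPf ki) mul0r.
have mulG x m (A : 'M[K]_(rdim V x, m)) i j : (G x *m A) i j = A (e' x i) j.
  rewrite mxE (bigD1 (e' x i)) //= mxE eqxx mul1r big1 ?addr0 // => k ki.
  by rewrite mxE eq_sym (negPf ki) mul0r.
have Fmul x m (A : 'M[K]_(m, rdim V x)) i j : (A *m F x) i j = A i (e' x j).
  rewrite mxE (bigD1 (e' x j)) //= mxE e'K eqxx mulr1 big1 ?addr0 // => k kj.
  by rewrite mxE -{1}[j]e'K (can_eq (eK x)) (negPf kj) mulr0.
have Gmul x m (A : 'M[K]_(m, rdim W x)) i j : (A *m G x) i j = A i (e x j).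
  rewrite mxE (bigD1 (e x j)) //= mxE eK eqxx mulr1 big1 ?addr0 // => k kj.
  by rewrite mxE -{1}[j]eK (can_eq (e'K x)) (negPf kj) mulr0.
exists F, G; split=> x; apply/matrixP => i j.
- by rewrite mulF Fmul eqVW e'K.
- by rewrite mulG Gmul eqVW e'K.
- by rewrite mulF !mxE eK.
- by rewrite mulG !mxE e'K.
Qed.

Lemma rep_iso_tensC V W : rep_iso (tens V W) (tens W V).
Proof.
pose e m n (i : 'I_(m * n)) : 'I_(n * m) :=
  mxtens_index ((mxtens_unindex i).2, (mxtens_unindex i).1).
have eK m n : cancel (@e m n) (@e n m).
  by move=> i; case: (mxtens_indexP i) => i1 i2; rewrite /e !mxtens_indexK.
apply: (@rep_iso_reindex (tens V W) (tens W V)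
  (fun x => @e _ _) (fun x => @e _ _)) => [x|x|a i j] //=.
case: (mxtens_indexP i) => i1 i2; case: (mxtens_indexP j) => j1 j2.
by rewrite /e !mxtens_indexK !tensmxE mulrC.
Qed.

Lemma rep_iso_tensA U V W :
  rep_iso (tens U (tens V W)) (tens (tens U V) W).
Proof.
pose e m n p (i : 'I_(m * (n * p))) : 'I_(m * n * p) :=
  let: (i1, i') := mxtens_unindex i in let: (i2, i3) := mxtens_unindex i' in
  mxtens_index (mxtens_index (i1, i2), i3).
pose e' m n p (i : 'I_(m * n * p)) : 'I_(m * (n * p)) :=
  let: (i', i3) := mxtens_unindex i in let: (i1, i2) := mxtens_unindex i' in
  mxtens_index (i1, mxtens_index (i2, i3)).
have eE m n p i1 i2 i3 : e m n p (mxtens_index (i1, mxtens_index (i2, i3))) =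
    mxtens_index (mxtens_index (i1, i2), i3).
  by rewrite /e !(mxtens_indexK, mxtens_indexK (_, _)).
have e'E m n p i1 i2 i3 : e' m n p (mxtens_index (mxtens_index (i1, i2), i3)) =
    mxtens_index (i1, mxtens_index (i2, i3)).
  by rewrite /e' !(mxtens_indexK, mxtens_indexK (_, _)).
apply: (@rep_iso_reindex (tens U (tens V W)) (tens (tens U V) W)
  (fun x => @e _ _ _) (fun x => @e' _ _ _)) => [x i|x i|a i j] /=.
- case: (mxtens_indexP i) => i1 i'; case: (mxtens_indexP i') => i2 i3.
  by rewrite eE e'E.
- case: (mxtens_indexP i) => i' i3; case: (mxtens_indexP i') => i1 i2.
  by rewrite e'E eE.
case: (mxtens_indexP i) => i1 i'; case: (mxtens_indexP i') => i2 i3.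
case: (mxtens_indexP j) => j1 j'; case: (mxtens_indexP j') => j2 j3.
by rewrite !eE !tensmxE mulrA.
Qed.

Lemma rep_iso_tens1 V : rep_iso (tens unit_rep V) V.
Proof.
pose e n (i : 'I_(1 * n)) : 'I_n := (mxtens_unindex i).2.
pose e' n (i : 'I_n) : 'I_(1 * n) := mxtens_index (ord0, i).
apply: (@rep_iso_reindex (tens unit_rep V) V
  (fun x => @e _) (fun x => @e' _)) => [x i|x i|a i j] /=.
- by case: (mxtens_indexP i) => i1 i2; rewrite /e /e' mxtens_indexK (ord1 i1).
- by rewrite /e /e' mxtens_indexK.
case: (mxtens_indexP i) => i1 i2; case: (mxtens_indexP j) => j1 j2.
by rewrite /e !mxtens_indexK tensmxE (ord1 i1) (ord1 j1) mxE eqxx mul1r.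
Qed.

Lemma rep_iso_tensDl U V W :
  rep_iso (tens (dsum U V) W) (dsum (tens U W) (tens V W)).
Proof.
pose e m n p (i : 'I_((m + n) * p)) : 'I_(m * p + n * p) :=
  let: (i', k) := mxtens_unindex i in
  match split i' with
  | inl i1 => lshift _ (mxtens_index (i1, k))
  | inr i2 => rshift _ (mxtens_index (i2, k))
  end.
pose e' m n p (i : 'I_(m * p + n * p)) : 'I_((m + n) * p) :=
  match split i with
  | inl i1 => let: (i', k) := mxtens_unindex i1 in
              mxtens_index (lshift _ i', k)
  | inr i2 => let: (i', k) := mxtens_unindex i2 in
              mxtens_index (rshift _ i', k)
  end.
have eL m n p (i : 'I_m) k :
    e m n p (mxtens_index (lshift _ i, k)) = lshift _ (mxtens_index (i, k)).
  by rewrite /e mxtens_indexK (unsplitK (inl _)).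
have eR m n p (i : 'I_n) k :
    e m n p (mxtens_index (rshift _ i, k)) = rshift _ (mxtens_index (i, k)).
  by rewrite /e mxtens_indexK (unsplitK (inr _)).
have e'L m n p (i : 'I_m) k :
    e' m n p (lshift _ (mxtens_index (i, k))) = mxtens_index (lshift _ i, k).
  by rewrite /e' (unsplitK (inl _)) mxtens_indexK.
have e'R m n p (i : 'I_n) k :
    e' m n p (rshift _ (mxtens_index (i, k))) = mxtens_index (rshift _ i, k).
  by rewrite /e' (unsplitK (inr _)) mxtens_indexK.
apply: (@rep_iso_reindex (tens (dsum U V) W) (dsum (tens U W) (tens V W))
  (fun x => @e _ _ _) (fun x => @e' _ _ _)) => [x i|x i|a i j] /=.
- case: (mxtens_indexP i) => i' k; rewrite -(splitK i').
  by case: (split i') => i0; rewrite /= (eL, eR) (e'L, e'R).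
- rewrite -(splitK i); case: (split i) => i0 /=.
  + by case: (mxtens_indexP i0) => i1 k; rewrite e'L eL.
  + by case: (mxtens_indexP i0) => i1 k; rewrite e'R eR.
case: (mxtens_indexP i) => i' k; case: (mxtens_indexP j) => j' l.
rewrite -(splitK i') -(splitK j') tensmxE.
case: (split i') => i0; case: (split j') => j0 /=; rewrite ?eL ?eR.
- by rewrite !block_mxEul tensmxE.
- by rewrite !block_mxEur !mxE mul0r.
- by rewrite !block_mxEdl !mxE mul0r.
- by rewrite !block_mxEdr tensmxE.
Qed.

Definition rep_isob V W : bool := `[< rep_iso V W >].

Lemma rep_isob_refl : reflexive rep_isob.
Proof. by move=> V; apply/asboolP/rep_iso_refl. Qed.

Lemma rep_isob_sym : symmetric rep_isob.
Proof. by move=> V W; apply/asboolP/asboolP; apply: rep_iso_sym. Qed.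

Lemma rep_isob_trans : transitive rep_isob.
Proof.
move=> V U W /asboolP UV /asboolP VW; apply/asboolP.
exact: rep_iso_trans VW.
Qed.

Canonical rep_iso_equiv :=
  EquivRel rep_isob rep_isob_refl rep_isob_sym rep_isob_trans.

Definition rep_class := {eq_quot rep_isob}.

HB.instance Definition _ := Choice.on rep_class.
HB.instance Definition _ : EqQuotient _ rep_isob rep_class :=
  EqQuotient.on rep_class.

Definition iso_class V : rep_class := \pi V.

Lemma iso_classP V W : iso_class V = iso_class W <-> rep_iso V W.
Proof. by split=> [/eqmodP/asboolP|VW] //; apply/eqmodP/asboolP. Qed.

Lemma iso_classK (c : rep_class) : iso_class (repr c) = c.
Proof. exact: reprK. Qed.

Definition tens_class (c d : rep_class) : rep_class :=
  iso_class (tens (repr c) (repr d)).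

Lemma tens_classE V W :
  tens_class (iso_class V) (iso_class W) = iso_class (tens V W).
Proof. by apply/iso_classP/rep_iso_tens; apply/iso_classP/iso_classK. Qed.

Lemma tens_classA : associative tens_class.
Proof.
move=> b c d; rewrite -[b]iso_classK -[c]iso_classK -[d]iso_classK.
by rewrite !tens_classE; apply/iso_classP/rep_iso_tensA.
Qed.

Lemma tens_classC : commutative tens_class.
Proof.
move=> c d; rewrite -[c]iso_classK -[d]iso_classK.
by rewrite !tens_classE; apply/iso_classP/rep_iso_tensC.
Qed.

Lemma tens_class1 : left_id (iso_class unit_rep) tens_class.
Proof.
move=> c; rewrite -[c]iso_classK.
by rewrite !tens_classE; apply/iso_classP/rep_iso_tens1.
Qed.

(* The free abelian group on isomorphism classes; [<< 1 *g c >>] is the basis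
   element given by the class [c]. *)
Definition class_group : zmodType := {freeg rep_class / int}.

Definition class_mul (a b : class_group) : class_group :=
  fglift (fun c => fglift (fun d => << 1 *g tens_class c d >>) b) a.

Definition class_elt V : class_group := << 1 *g iso_class V >>.

Lemma class_ind (P : class_group -> Prop) :
  (forall a b, P a -> P b -> P (a - b)) -> (forall V, P (class_elt V)) ->
  forall a, P a.
Proof.
move=> PB Pelt a.
have P0 : P 0 by rewrite -(subrr (class_elt unit_rep)); apply: PB.
have PN b : P b -> P (- b) by rewrite -sub0r; apply: PB.
have PD b c : P b -> P c -> P (b + c).
  by move=> Pb Pc; rewrite -[c]opprK; apply: PB => //; apply: PN.
have PMn b n : P b -> P (b *+ n).
  by move=> Pb; elim: n => [|n IHn] //; rewrite mulrS; apply: PD.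
have PMz b (n : int) : P b -> P (b *~ n).
  case: n => n Pb; last by rewrite NegzE mulrNz -pmulrn; apply/PN/PMn.
  by rewrite -pmulrn; apply: PMn.
rewrite -[a](@freeg_sumE int rep_class).
elim: (dom _) => [|c s IHs]; first by rewrite big_nil.
rewrite big_cons; apply: PD => //.
rewrite -[coeff c a]intz -freegU_mulz -[c]iso_classK.
exact: PMz (Pelt _).
Qed.

Lemma class_mulBl a b c : class_mul (a - b) c = class_mul a c - class_mul b c.
Proof. exact: lift_is_additive. Qed.

Lemma class_mulDl a b c : class_mul (a + b) c = class_mul a c + class_mul b c.
Proof.
have mul0 : class_mul 0 c = 0 by have := class_mulBl a a c; rewrite !subrr.
have mulN : class_mul (- b) c = - class_mul b c.
  by rewrite -[- b]sub0r class_mulBl mul0 sub0r.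
by rewrite -[b in LHS]opprK class_mulBl mulN opprK.
Qed.

Lemma class_mulBr a b c : class_mul c (a - b) = class_mul c a - class_mul c b.
Proof.
elim/class_ind: c => [c d cE dE|V].
  by rewrite !class_mulBl cE dE opprD addrACA -opprD.
rewrite /class_mul !liftU !scale1r; exact: lift_is_additive.
Qed.

Lemma class_mul_elt V W :
  class_mul (class_elt V) (class_elt W) = class_elt (tens V W).
Proof. by rewrite /class_mul !liftU !scale1r tens_classE. Qed.

Lemma class_mulC : commutative class_mul.
Proof.
elim/class_ind=> [a b aE bE c|V].
  by rewrite class_mulBl class_mulBr aE bE.
elim/class_ind=> [a b aE bE|W]; first by rewrite class_mulBl class_mulBr aE bE.
rewrite !class_mul_elt /class_elt; congr << _ *g _ >>.
exact/iso_classP/rep_iso_tensC.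
Qed.

Lemma class_mulA : associative class_mul.
Proof.
elim/class_ind=> [a b aE bE c d|U]; first by rewrite !class_mulBl aE bE.
elim/class_ind=> [a b aE bE d|V].
  by rewrite !(class_mulBl, class_mulBr) aE bE.
elim/class_ind=> [a b aE bE|W]; first by rewrite !class_mulBr aE bE.
rewrite !class_mul_elt /class_elt; congr << _ *g _ >>.
exact/iso_classP/rep_iso_tensA.
Qed.

Lemma class_mul1 : left_id (class_elt unit_rep) class_mul.
Proof.
elim/class_ind=> [a b aE bE|V]; first by rewrite class_mulBr aE bE.
rewrite class_mul_elt /class_elt; congr << _ *g _ >>.
exact/iso_classP/rep_iso_tens1.
Qed.

Definition is_subgroup (G : zmodType) (S : set G) : Prop :=
  (exists a, S a) /\ (forall a b, S a -> S b -> S (a - b)).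

Definition dsum_relations : set class_group :=
  [set r | exists V W, r = class_elt (dsum V W) - class_elt V - class_elt W].

Definition rel_subgroup : set class_group :=
  smallest (@is_subgroup class_group) dsum_relations.

Lemma rel_subgroupP : is_subgroup rel_subgroup.
Proof.
split=> [|a b Sa Sb S SP]; last by apply: SP.1.2; [apply: Sa|apply: Sb].
exists 0 => S [[[a Sa] SB] _]; rewrite -(subrr a); exact: SB.
Qed.

Lemma rel_subgroup_mull a b : rel_subgroup b -> rel_subgroup (class_mul b a).
Proof.
have [[c0 Sc0] SB] := rel_subgroupP.
have S0 : rel_subgroup 0 by rewrite -(subrr c0); apply: SB.
elim/class_ind: a => [a a' aE a'E Sb|U].
  by rewrite class_mulBr; apply: SB; [apply: aE|apply: a'E].
apply: (@smallest_sub _ _ _ [set b | rel_subgroup (class_mul b (class_elt U))]).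
  split=> [|c d /= Sc Sd]; last by rewrite class_mulBl; apply: SB.
  by exists 0 => /=; rewrite -(subrr c0) class_mulBl subrr.
move=> _ [V [W ->]] /=; rewrite !class_mulBl !class_mul_elt.
have -> : class_elt (tens (dsum V W) U) =
    class_elt (dsum (tens V U) (tens W U)).
  by congr << _ *g _ >>; apply/iso_classP/rep_iso_tensDl.
by apply: sub_gen_smallest; exists (tens V U), (tens W U).
Qed.

Definition rel_pred : {pred class_group} := fun a => `[< rel_subgroup a >].

Lemma rel_pred_zmod_closed : zmod_closed rel_pred.
Proof.
have [[c Sc] SB] := rel_subgroupP; split=> [|a b].
  by apply/asboolP; rewrite -(subrr c); apply: SB.
by move=> /asboolP Sa /asboolP Sb; apply/asboolP; exact: SB.
Qed.

HB.instance Definition _ :=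
  GRing.isZmodClosed.Build class_group rel_pred rel_pred_zmod_closed.

(* [rel_subgroup] is an ideal by [rel_subgroup_mull]. The quotient is formed as
   an abelian group, and multiplied by hand, because the ring quotient of
   MathComp requires a proper ideal, while this one is the whole ring if [Q]
   has no vertices. *)
Definition rep_ring := Quotient.quot rel_pred.

HB.instance Definition _ := GRing.Zmodule.on rep_ring.
HB.instance Definition _ := Quotient.on rep_ring.

Lemma rep_ring_piP (a b : class_group) :
  reflect (rel_subgroup (a - b)) (\pi_rep_ring a == \pi_rep_ring b).
Proof. by rewrite -[_ == _]Quotient.idealrBE; apply: asboolP. Qed.

Lemma rep_ring_piD (a b : class_group) :
  \pi_rep_ring (a + b) = \pi_rep_ring a + \pi_rep_ring b.
Proof. by rewrite Quotient.pi_add. Qed.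

Lemma rep_ring_piB (a b : class_group) :
  \pi_rep_ring (a - b) = \pi_rep_ring a - \pi_rep_ring b.
Proof. by rewrite rep_ring_piD Quotient.pi_opp. Qed.

Definition rep_mul := lift_op2 rep_ring class_mul.

Lemma rep_mulE (a b : class_group) :
  rep_mul (\pi_rep_ring a) (\pi_rep_ring b) = \pi_rep_ring (class_mul a b).
Proof.
unlock rep_mul; apply/eqP/rep_ring_piP; set a' := repr _; set b' := repr _.
have Sa : rel_subgroup (a' - a) by apply/rep_ring_piP; rewrite reprK.
have Sb : rel_subgroup (b' - b) by apply/rep_ring_piP; rewrite reprK.
have -> : class_mul a' b' - class_mul a b =
    class_mul (a' - a) b' - class_mul (b - b') a.
  rewrite !class_mulBl [class_mul b a]class_mulC [class_mul b' a]class_mulC.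
  by rewrite opprB addrA subrK.
apply: rel_subgroupP.2; apply: rel_subgroup_mull => //.
have [[c Sc] SB] := rel_subgroupP.
by rewrite -opprB -sub0r -(subrr c); apply: (SB) => //; apply: (SB).
Qed.

Lemma rep_mulA : associative rep_mul.
Proof.
elim/quotW=> a; elim/quotW=> b; elim/quotW=> c.
by rewrite !rep_mulE class_mulA.
Qed.

Lemma rep_mulC : commutative rep_mul.
Proof.
by elim/quotW=> a; elim/quotW=> b; rewrite !rep_mulE class_mulC.
Qed.

Lemma rep_mul1 : left_id (\pi_rep_ring (class_elt unit_rep)) rep_mul.
Proof. by elim/quotW=> a; rewrite rep_mulE class_mul1. Qed.

Lemma rep_mulDl : left_distributive rep_mul +%R.
Proof.
elim/quotW=> a; elim/quotW=> b; elim/quotW=> c.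
by rewrite -rep_ring_piD !rep_mulE -rep_ring_piD class_mulDl.
Qed.

HB.instance Definition _ := GRing.Zmodule_isComPzRing.Build rep_ring
  rep_mulA rep_mulC rep_mul1 rep_mulDl.

Definition rep_elt V : rep_ring := \pi_rep_ring (class_elt V).

Lemma rep_elt_dsum V W : rep_elt (dsum V W) = rep_elt V + rep_elt W.
Proof.
rewrite -rep_ring_piD; apply/eqP/rep_ring_piP.
by apply: sub_gen_smallest; exists V, W; rewrite opprD addrA.
Qed.

Lemma rep_elt_tens V W : rep_elt (tens V W) = rep_elt V * rep_elt W.
Proof. by rewrite /rep_elt -class_mul_elt -rep_mulE. Qed.

End Representations.

Arguments rep_elt {K Q} V.
Arguments rep_ring K Q : clear implicits.

(* Closed under subtraction and multiplication; need not contain [1]. *)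
Definition is_subring (R : pzRingType) (S : set R) : Prop :=
  [/\ exists a, S a, forall a b, S a -> S b -> S (a - b)
    & forall a b, S a -> S b -> S (a * b)].

Definition generated_subring (R : pzRingType) (A : set R) : set R :=
  smallest (@is_subring R) A.

(* [M] is isomorphic, as a ring not required to have an identity, to the
   subring [S] of [R]. *)
Definition isomorphic_to_subring (M R : pzRingType) (S : set R) : Prop :=
  exists phi : M -> R,
    [/\ {morph phi : a b / a + b}, {morph phi : a b / a * b},
         injective phi & range phi = S].

Section Linearization.
Variables (K : fieldType) (Q : quiver) (X : quiver_over Q).

Definition fiber_at (x : vert Q) : {pred vert X} :=
  [pred v | hom_vert (structure_map X) v == x].

(* The basis vectors at [x] are indexed by [enum_val : 'I_#|fiber_at x| ->
   vert X]; [lin_arrow a b] is the matrix of the map sending the basis vector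
   at [src b] to the one at [tgt b], and the others to [0]. *)
Definition lin_arrow (a : arrow Q) (b : arrow X) :
    'M[K]_(#|fiber_at (src a)|, #|fiber_at (tgt a)|) :=
  \matrix_(i, j) ((enum_val i == src b) && (enum_val j == tgt b))%:R.

Definition linearization : rep K Q :=
  @Rep K Q (fun x => #|fiber_at x|)
    (fun a => \sum_(b : arrow X | hom_arrow (structure_map X) b == a)
      lin_arrow a b).

End Linearization.

Arguments linearization K {Q} X.

(* Main.v *)
(* The map sending the basis element x of the Möbius ring to [L(x)] is
   multiplicative: in the Möbius ring the coordinates of x on the idempotents are
   the numbers [w,x], and if the fiber product of x and y is the disjoint union of
   z_1, ..., z_n, then [w,x][w,y] is the sum of the [w,z_i] because w is connected;
   on the other side L turns fiber products into tensor products and disjoint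
   unions into direct sums. It is injective because non-isomorphic indecomposables
   are independent in R(Q). Instead of the full Krull-Schmidt theorem this uses,
   for an indecomposable U, the additive function
   V |-> dim Hom(U,V) - dim rad(U,V), where rad(U,V) consists of the F such that no
   composite U -> V -> U starting with F is invertible; it is a subspace by Fitting's
   lemma. This function vanishes on the indecomposables not isomorphic to U, but
   not on U. *)
From HB Require Import structures.
Require Import Defs.
From mathcomp Require Import all_boot all_order all_algebra.
From mathcomp Require Import boolp classical_sets.
From mathcomp Require Import mxtens freeg ring.

Set Implicit Arguments.
Unset Strict Implicit.
Unset Printing Implicit Defensive.

Import GRing.Theory.
Local Open Scope ring_scope.
Local Open Scope quotient_scope.

(** * Endomorphisms of indecomposable representations *)

Section PolyMatrix.
Variable K : fieldType.
Implicit Types (p q : {poly K}).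

(* [horner_mx] requires a positive size, while the space of a representation at
   a vertex may be zero. *)
Definition poly_mx n p : 'M[K]_n -> 'M[K]_n :=
  if n is n'.+1 then fun A => horner_mx A p else fun=> 0.

Lemma poly_mxC n c (A : 'M_n) : poly_mx c%:P A = c%:M.
Proof. by case: n A => [|n] A; [rewrite !flatmx0|rewrite /= horner_mx_C]. Qed.

Lemma poly_mxX n (A : 'M_n) : poly_mx 'X A = A.
Proof. by case: n A => [|n] A; [rewrite !flatmx0|rewrite /= horner_mx_X]. Qed.

Lemma poly_mxD n p q (A : 'M_n) : poly_mx (p + q) A = poly_mx p A + poly_mx q A.
Proof. by case: n A => [|n] A; [rewrite !flatmx0|rewrite /= rmorphD]. Qed.

Lemma poly_mxM n p q (A : 'M_n) : poly_mx (p * q) A = poly_mx p A *m poly_mx q A.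
Proof. by case: n A => [|n] A; [rewrite !flatmx0|rewrite /= rmorphM]. Qed.

Lemma poly_mxB n p q (A : 'M_n) : poly_mx (p - q) A = poly_mx p A - poly_mx q A.
Proof. by case: n A => [|n] A; [rewrite !flatmx0|rewrite /= rmorphB]. Qed.

Lemma poly_mx1 n (A : 'M_n) : poly_mx 1 A = 1%:M.
Proof. exact: poly_mxC. Qed.

Lemma poly_mx_char n (A : 'M_n) : poly_mx (char_poly A) A = 0.
Proof. by case: n A => [|n] A //=; rewrite Cayley_Hamilton. Qed.

(** Induction on [p] in Horner form. With [C] the map over an arrow, it shows that a polynomial in
    an endomorphism is again an endomorphism. *)
Lemma poly_mx_comm m n p (A : 'M_m) (B : 'M_n) (C : 'M_(m, n)) :
  A *m C = C *m B -> poly_mx p A *m C = C *m poly_mx p B.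
Proof.
move=> AC; elim/poly_ind: p => [|p c IHp].
  by rewrite -[0]/(0%:P) !poly_mxC scalar_mxC.
rewrite !poly_mxD !poly_mxM !poly_mxC !poly_mxX mulmxDl mulmxDr scalar_mxC.
by rewrite -mulmxA AC !mulmxA IHp.
Qed.

End PolyMatrix.

(** * Idempotents, Fitting's lemma and locality of End(U) *)

Section Endomorphisms.
Variables (K : fieldType) (Q : quiver).
Implicit Types U V W : rep K Q.

Notation family U V := (forall x : vert Q, 'M[K]_(rdim U x, rdim V x)).

(** The matrices are square, so a right inverse is two-sided. *)
Definition invertible_endo U (F : family U U) :=
  exists2 G : family U U, is_rep_hom G & forall x, F x *m G x = 1%:M.

Lemma is_rep_hom1 U : is_rep_hom (fun x => 1%:M : 'M_(rdim U x)).
Proof. by move=> a; rewrite mulmx1 mul1mx. Qed.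

Lemma is_rep_hom_mul U V W (F : family U V) (G : family V W) :
  is_rep_hom F -> is_rep_hom G -> is_rep_hom (fun x => F x *m G x).
Proof. by move=> hF hG a; rewrite mulmxA hF -!mulmxA hG. Qed.

Lemma is_rep_hom_lin U V c (F G : family U V) :
  is_rep_hom F -> is_rep_hom G -> is_rep_hom (fun x => c *: F x + G x).
Proof.
by move=> hF hG a; rewrite mulmxDr mulmxDl -scalemxAr -scalemxAl hF hG.
Qed.

Lemma is_rep_hom_poly U p (F : family U U) :
  is_rep_hom F -> is_rep_hom (fun x => poly_mx p (F x)).
Proof. by move=> hF a; rewrite (poly_mx_comm p (esym (hF a))). Qed.

(** For an endomorphism [P] this is its image: maps act on row vectors, so the image at [x] is the
    row space of [P x], with basis [row_base (P x)], and [pinvmx] takes coordinates in that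
    basis. *)
Definition image_rep U (P : family U U) : rep K Q :=
  @Rep K Q (fun x => \rank (P x))
    (fun a => row_base (P (src a)) *m rmap U a *m pinvmx (row_base (P (tgt a)))).

Lemma image_rep_incl U (P : family U U) :
  is_rep_hom P ->
  is_rep_hom ((fun x => row_base (P x)) : family (image_rep P) U).
Proof.
(* What remains is that [rmap U a] carries the row space of [P (src a)] into that of [P (tgt a)];
   this follows from [hP]. *)
move=> hP a; apply: mulmxKpV; rewrite eq_row_base.
have /submxP[B ->] : (row_base (P (src a)) <= P (src a))%MS by rewrite eq_row_base.
by rewrite -mulmxA -hP mulmxA submxMl.
Qed.

Lemma image_rep_proj U (P : family U U) :
  is_rep_hom P ->
  is_rep_hom ((fun x => P x *m pinvmx (row_base (P x))) : family U (image_rep P)).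
Proof.
move=> hP a; have Pbase := mulmxKpV (_ : P (src a) <= row_base (P (src a)))%MS.
rewrite /= mulmxA hP -{1}Pbase ?eq_row_base //.
exact/esym/(etrans (mulmxA _ _ _))/(congr1 (mulmx^~ _))/mulmxA.
Qed.

(** [P] and [1 - P] each factor as a projection onto the image followed by its inclusion. They
    annihilate each other and sum to 1, so these maps assemble to mutually inverse isomorphisms. *)
Lemma idempotent_split U (P : family U U) :
  is_rep_hom P -> (forall x, P x *m P x = P x) ->
  rep_iso U (dsum (image_rep P) (image_rep (fun x => 1%:M - P x))).
Proof.
move=> hP PP; pose P' x := 1%:M - P x.
have hP' : is_rep_hom P'.
  by move=> a; rewrite mulmxBr mulmxBl mulmx1 mul1mx hP.
have PP' x : P x *m P' x = 0 by rewrite mulmxBr mulmx1 PP subrr.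
have P'P x : P' x *m P x = 0 by rewrite mulmxBl mul1mx PP subrr.
have P'P' x : P' x *m P' x = P' x by rewrite {1}/P' mulmxBl mul1mx PP' subr0.
have fact (R : family U U) x :
    R x *m pinvmx (row_base (R x)) *m row_base (R x) = R x.
  by rewrite mulmxKpV // eq_row_base.
have cancel (R S : family U U) x : R x *m S x = 0 ->
    row_base (R x) *m (S x *m pinvmx (row_base (S x))) = 0.
  move=> RS; have /submxP[B ->] : (row_base (R x) <= R x)%MS by rewrite eq_row_base.
  by rewrite -mulmxA (mulmxA (R x)) RS mul0mx mulmx0.
have cancel1 (R : family U U) x : R x *m R x = R x ->
    row_base (R x) *m (R x *m pinvmx (row_base (R x))) = 1%:M.
  move=> RR; have : row_base (R x) *m R x = row_base (R x).
    have /submxP[B ->] : (row_base (R x) <= R x)%MS by rewrite eq_row_base.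
    by rewrite -mulmxA RR.
  by move=> E; rewrite mulmxA E mulmxVp // row_base_free.
pose F x := row_mx (P x *m pinvmx (row_base (P x)))
  (P' x *m pinvmx (row_base (P' x))).
pose G x := col_mx (row_base (P x)) (row_base (P' x)).
exists F, G; split=> [a|a|x|x] /=.
- rewrite mul_mx_row mul_row_block !mulmx0 addr0 add0r.
  by rewrite (image_rep_proj hP) (image_rep_proj hP').
- apply: etrans (mul_block_col _ _ _ _ _ _) _.
  rewrite mul_col_mx !mul0mx addr0 add0r.
  by rewrite (image_rep_incl hP) (image_rep_incl hP').
- by rewrite mul_row_col !fact addrC subrK.
rewrite mul_col_row !cancel1 // !cancel //.
by rewrite -scalar_mx_block.
Qed.

Lemma indecomposable_idempotent U (P : family U U) :
  indecomposable U -> is_rep_hom P -> (forall x, P x *m P x = P x) ->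
  (forall x, P x = 0) \/ (forall x, P x = 1%:M).
Proof.
move=> [_ indec] hP PP; have [z|z] := indec _ _ (idempotent_split hP PP).
  by left=> x; apply/eqP; rewrite -mxrank_eq0; apply/eqP/z.
right=> x; apply/esym/eqP; rewrite -subr_eq0 -mxrank_eq0.
by apply/eqP/z.
Qed.

Lemma fitting U (F : family U U) : indecomposable U -> is_rep_hom F ->
  invertible_endo F \/ exists k, forall x, poly_mx 'X^k (F x) = 0.
Proof.
(* Write the product of the characteristic polynomials as [r * 'X^k] with [r]
   coprime to ['X]. If [u * 'X^(k.+1) + v * r = 1], then [u * 'X^(k.+1)] evaluated
   at [F] is idempotent. *)
move=> indec hF.
pose chi := \prod_x char_poly (F x).
have chi0 x : poly_mx chi (F x) = 0.
  by rewrite /chi (bigD1 x) //= poly_mxM poly_mx_char mul0mx.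
have chiN0 : chi != 0.
  by apply/prodf_neq0 => x _; rewrite monic_neq0 // char_poly_monic.
have [k [r r0 chiE]] := multiplicity_XsubC chi 0.
rewrite chiN0 /= in r0; rewrite subr0 in chiE.
(* The exponent is [k.+1] so that a factor ['X] can be split off even if [k = 0]; this provides the
   inverse of [F] in the last case. *)
have /Bezout_eq1_coprimepP[[u v] /= uv] : coprimep ('X^(k.+1)) r.
  rewrite coprimep_sym; apply: coprimep_expr.
  by rewrite -['X]subr0 -[0]/(0%:P) coprimep_XsubC.
have eval1 x : poly_mx (u * 'X^(k.+1)) (F x) + poly_mx (v * r) (F x) = 1%:M.
  by rewrite -poly_mxD uv poly_mx1.
have eval0 p x : poly_mx (p * chi) (F x) = 0 by rewrite poly_mxM chi0 mulmx0.
have hP := is_rep_hom_poly (u * 'X^(k.+1)) hF.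
have [x|P0|P1] := indecomposable_idempotent indec hP.
(* Idempotency: the product of [u * 'X^(k.+1)] with its complement [v * r] is a multiple of [chi],
   which vanishes at every [F x] by Cayley-Hamilton. *)
- rewrite -[RHS]mul1mx -eval1 mulmxDl -[LHS]addr0; congr (_ + _).
  rewrite -poly_mxM; have -> : v * r * (u * 'X^(k.+1)) = v * u * 'X * chi.
    by rewrite chiE exprS; ring.
  by rewrite eval0.
(* If the idempotent is 0, then [v * r] evaluates to 1, so ['X^k] takes the same value as [v * chi],
   which is 0. *)
- right; exists k => x; rewrite -[LHS]mul1mx -(eval1 x) P0 add0r -poly_mxM.
  by rewrite -mulrA -chiE.
left; exists (fun x => poly_mx (u * 'X^k) (F x)); first exact: is_rep_hom_poly.
move=> x; rewrite -(P1 x) -{1}(poly_mxX (F x)) -poly_mxM exprS; congr poly_mx.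
by rewrite mulrCA.
Qed.

(** If [H] inverts [F + G], then [FH + GH = 1]. By Fitting's lemma [FH] is invertible, or it is
    nilpotent and a geometric series inverts [GH = 1 - FH]. *)
Lemma invertible_endo_local U (F G : family U U) :
  indecomposable U -> is_rep_hom F -> is_rep_hom G ->
  invertible_endo (fun x => F x + G x) -> invertible_endo F \/ invertible_endo G.
Proof.
move=> indec hF hG [H hH FGH].
have factor (E : family U U) :
    invertible_endo (fun x => E x *m H x) -> invertible_endo E.
  move=> [L hL EHL]; exists (fun x => H x *m L x); first exact: is_rep_hom_mul.
  by move=> x; rewrite mulmxA.
have hE := is_rep_hom_mul hF hH.
have [inv|[k Ek]] := fitting indec hE; first by left; apply: factor.
right; apply: factor.
have [q qE] : exists q : {poly K}, 'X^k - 1 = ('X - 1) * q.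
  by rewrite subrX1; eexists.
exists (fun x => poly_mx q (F x *m H x)); first exact: is_rep_hom_poly.
move=> x; have -> : G x *m H x = poly_mx (1 - 'X) (F x *m H x).
  by rewrite poly_mxB poly_mx1 poly_mxX -FGH mulmxDl addrAC subrr add0r.
by rewrite -poly_mxM -opprB mulNr -qE opprB poly_mxB poly_mx1 Ek subr0.
Qed.

End Endomorphisms.

(** * Dimensions of subfunctors of Hom(U, -) *)

Section VectorSpaces.
Variable K : fieldType.

(** A subspace of largest dimension among those contained in [P] is all of [P], since adjoining
    another vector of [P] would enlarge it. *)
Lemma vspace_of_pred (vT : vectType K) (P : set vT) :
  P 0 -> (forall c u v, P u -> P v -> P (c *: u + v)) ->
  exists S : {vspace vT}, forall v, v \in S <-> P v.
Proof.
move=> P0 Plin.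
pose D d := `[< exists2 S : {vspace vT}, \dim S = d & forall v, v \in S -> P v >].
have exD : exists d, D d.
  exists 0%N; apply/asboolP; exists 0%VS => [|v];
    by rewrite ?dimv0 // memv0 => /eqP->.
have ubD d : D d -> (d <= \dim {:vT})%N.
  by move=> /asboolP[S <- _]; apply/dimvS/subvf.
have [d /asboolP[S dimS SP] maxd] := ex_maxnP exD ubD.
exists S => v; split=> [/SP//|Pv].
have : (\dim (S + <[v]>)%VS <= \dim S)%N.
  rewrite dimS; apply: maxd; apply/asboolP; exists (S + <[v]>)%VS => // w.
  move=> /memv_addP[s Ss [_ /vlineP[c ->] ->]]; rewrite addrC.
  by apply: Plin => //; apply: SP.
rewrite (geq_leqif (dimv_leqif_sup (addvSl _ _))) => /subvP-> //.
by apply/(subvP (addvSr _ _))/memv_line.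
Qed.

(** [S] is the direct sum of the images of [S1] and [S2]: the projections decompose each vector of
    [S], and applying [p1] to a common vector of the two images shows that it is 0. *)
Lemma dim_biproduct (T1 T2 T : vectType K) (i1 : 'Hom(T1, T)) (i2 : 'Hom(T2, T))
    (p1 : 'Hom(T, T1)) (p2 : 'Hom(T, T2))
    (S1 : {vspace T1}) (S2 : {vspace T2}) (S : {vspace T}) :
  cancel i1 p1 -> cancel i2 p2 -> (forall v, p1 (i2 v) = 0) ->
  (forall v, i1 (p1 v) + i2 (p2 v) = v) ->
  (i1 @: S1 <= S)%VS -> (i2 @: S2 <= S)%VS ->
  (p1 @: S <= S1)%VS -> (p2 @: S <= S2)%VS ->
  \dim S = (\dim S1 + \dim S2)%N.
Proof.
move=> K1 K2 p1i2 sum i1S i2S p1S p2S.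
have dimi (T' : vectType K) (i : 'Hom(T', T)) p (S' : {vspace T'}) :
    cancel i p -> \dim (i @: S') = \dim S'.
  move=> ip; apply: limg_dim_eq; have /eqP-> : lker i == 0%VS.
    exact/lker0P/(can_inj ip).
  by rewrite capv0.
rewrite -(dimi _ _ _ S1 K1) -(dimi _ _ _ S2 K2) -dimv_disjoint_sum.
  congr (\dim _); apply/eqP; rewrite eqEsubv subv_add i1S i2S !andbT.
  apply/subvP=> v Sv; rewrite -(sum v).
  apply: memv_add; apply: memv_img.
    by move/subvP: p1S; apply; apply: memv_img.
  by move/subvP: p2S; apply; apply: memv_img.
apply/eqP; rewrite -subv0; apply/subvP => v.
move=> /memv_capP[/memv_imgP[a _ ->] /memv_imgP[b _ /(congr1 p1)]].
by rewrite K1 p1i2 => ->; rewrite linear0 mem0v.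
Qed.

End VectorSpaces.

Section HomDimension.
Variables (K : fieldType) (Q : quiver).
Implicit Types U V W : rep K Q.

Notation family U V := (forall x : vert Q, 'M[K]_(rdim U x, rdim V x)).

(** All families of matrices, whether or not they are morphisms, as functions on the entries. Since
    the sizes vary with the vertex, the entries are indexed by a dependent sum. *)
Definition hom_space U V : vectType K :=
  {ffun {x : vert Q & 'I_(rdim U x) * 'I_(rdim V x)}%type -> K^o}.

Definition family_of U V (f : hom_space U V) : family U V :=
  fun x => \matrix_(i, j)
    f (Tagged (fun x => 'I_(rdim U x) * 'I_(rdim V x))%type (i, j)).

Definition of_family U V (F : family U V) : hom_space U V :=
  [ffun k => F (tag k) (tagged k).1 (tagged k).2].

Lemma family_ofK U V : cancel (@family_of U V) (@of_family U V).
Proof. by move=> f; apply/ffunP => -[x [i j]]; rewrite ffunE mxE. Qed.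

Lemma of_familyK U V : cancel (@of_family U V) (@family_of U V).
Proof.
move=> F; apply: functional_extensionality_dep => x.
by apply/matrixP => i j; rewrite mxE ffunE.
Qed.

Lemma family_of_lin U V c (f g : hom_space U V) :
  family_of (c *: f + g) = fun x => c *: family_of f x + family_of g x.
Proof.
apply: functional_extensionality_dep => x.
by apply/matrixP => i j; rewrite !mxE !ffunE.
Qed.

Lemma family_of0 U V : family_of (0 : hom_space U V) = fun x => 0.
Proof.
apply: functional_extensionality_dep => x.
by apply/matrixP => i j; rewrite !mxE ffunE.
Qed.

Definition postcomp U V W (H : family V W) (f : hom_space U V) : hom_space U W :=
  of_family (fun x => family_of f x *m H x).

Lemma postcomp_linear U V W (H : family V W) : linear (@postcomp U V W H).
Proof.
move=> c f g; apply: (can_inj (@family_ofK _ _)).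
rewrite family_of_lin /postcomp !of_familyK family_of_lin.
by apply: functional_extensionality_dep => x; rewrite mulmxDl scalemxAl.
Qed.

HB.instance Definition _ U V W (H : family V W) :=
  GRing.isLinear.Build K (hom_space U V) (hom_space U W) _ (postcomp H)
    (postcomp_linear H).

Lemma postcomp_comp U V V' W (H : family V V') (H' : family V' W)
    (f : hom_space U V) :
  postcomp H' (postcomp H f) = postcomp (fun x => H x *m H' x) f.
Proof.
rewrite /postcomp of_familyK; congr of_family.
by apply: functional_extensionality_dep => x; rewrite mulmxA.
Qed.

Lemma postcompD U V W (H H' : family V W) (f : hom_space U V) :
  postcomp H f + postcomp H' f = postcomp (fun x => H x + H' x) f.
Proof. by apply/ffunP => k; rewrite !ffunE mulmxDr [RHS]mxE. Qed.

Lemma postcomp_id U V (H : family V V) (f : hom_space U V) :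
  (forall x, H x = 1%:M) -> postcomp H f = f.
Proof.
move=> H1; rewrite -[RHS]family_ofK; congr of_family.
by apply: functional_extensionality_dep => x; rewrite H1 mulmx1.
Qed.

Lemma postcomp_0 U V W (H : family V W) (f : hom_space U V) :
  (forall x, H x = 0) -> postcomp H f = 0.
Proof. by move=> H0; apply/ffunP => k; rewrite !ffunE H0 mulmx0 mxE. Qed.

(** Common abstraction of Hom(U, -) and its radical, so that additivity of dimension is proved once
    for both. *)
Record hom_subfunctor U := HomSubfunctor {
  sub_hom :> forall V, family U V -> Prop;
  sub_hom0 : forall V, sub_hom (fun x => 0 : 'M_(rdim U x, rdim V x));
  sub_hom_lin : forall V c (F G : family U V),
    sub_hom F -> sub_hom G -> sub_hom (fun x => c *: F x + G x);
  sub_hom_post : forall V W (F : family U V) (H : family V W),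
    sub_hom F -> is_rep_hom H -> sub_hom (fun x => F x *m H x)
}.

Section Dimension.
Variables (U : rep K Q) (P : hom_subfunctor U).

Lemma sub_hom_vspace_subproof V :
  exists S : {vspace hom_space U V}, forall f, f \in S <-> P V (family_of f).
Proof.
apply: (@vspace_of_pred _ _ [set f | P V (family_of f)]) => /= [|c f g Pf Pg].
  by rewrite family_of0; apply: sub_hom0.
by rewrite family_of_lin; apply: sub_hom_lin.
Qed.

Definition sub_hom_vspace V := projT1 (cid (sub_hom_vspace_subproof V)).

Definition sub_hom_dim V := \dim (sub_hom_vspace V).

Lemma mem_sub_hom V f : f \in sub_hom_vspace V <-> P V (family_of f).
Proof. exact: (projT2 (cid (sub_hom_vspace_subproof V))). Qed.

Lemma postcomp_sub V W (H : family V W) : is_rep_hom H ->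
  (linfun (postcomp H) @: sub_hom_vspace V <= sub_hom_vspace W)%VS.
Proof.
move=> hH; apply/subvP => _ /memv_imgP[f /mem_sub_hom Pf ->].
by apply/mem_sub_hom; rewrite lfunE /= of_familyK; apply: sub_hom_post.
Qed.

(** Linear functors preserve biproducts: the inclusions and projections of the direct sum are
    morphisms, so postcomposition with them respects the subspaces. *)
Lemma sub_hom_dim_dsum V W :
  sub_hom_dim (dsum V W) = (sub_hom_dim V + sub_hom_dim W)%N.
Proof.
pose i1 x : 'M[K]_(rdim V x, rdim (dsum V W) x) := row_mx 1%:M 0.
pose i2 x : 'M[K]_(rdim W x, rdim (dsum V W) x) := row_mx 0 1%:M.
pose p1 x : 'M[K]_(rdim (dsum V W) x, rdim V x) := col_mx 1%:M 0.
pose p2 x : 'M[K]_(rdim (dsum V W) x, rdim W x) := col_mx 0 1%:M.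
apply: (@dim_biproduct _ _ _ _ (linfun (postcomp i1)) (linfun (postcomp i2))
    (linfun (postcomp p1)) (linfun (postcomp p2))) => [f|f|f|f||||].
- rewrite !lfunE /= postcomp_comp; apply: postcomp_id => x.
  by rewrite mul_row_col mulmx1 mul0mx addr0.
- rewrite !lfunE /= postcomp_comp; apply: postcomp_id => x.
  by rewrite mul_row_col mulmx1 mul0mx add0r.
- rewrite !lfunE /= postcomp_comp; apply: postcomp_0 => x.
  by rewrite mul_row_col mulmx0 mul0mx add0r.
- rewrite !lfunE /= !postcomp_comp postcompD.
  apply: (@postcomp_id U (dsum V W)) => x.
  rewrite !mul_col_row !mulmx1 !mul1mx !mul0mx add_block_mx !addr0 !add0r.
  by rewrite -scalar_mx_block.
- apply: postcomp_sub => a; rewrite mul_mx_row mulmx1 mulmx0.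
  by rewrite mul_row_block !mul1mx !mul0mx !addr0.
- apply: postcomp_sub => a; rewrite mul_mx_row mulmx1 mulmx0.
  by rewrite mul_row_block !mul1mx !mul0mx !add0r.
- apply: postcomp_sub => a; apply: etrans (mul_block_col _ _ _ _ _ _) _.
  by rewrite mul_col_mx mul1mx mul0mx !mulmx1 !mulmx0 !addr0.
- apply: postcomp_sub => a; apply: etrans (mul_block_col _ _ _ _ _ _) _.
  by rewrite mul_col_mx mul1mx mul0mx !mulmx1 !mulmx0 !add0r.
Qed.

Lemma sub_hom_dim_iso V W : rep_iso V W -> sub_hom_dim V = sub_hom_dim W.
Proof.
have leq V' W' : rep_iso V' W' -> (sub_hom_dim V' <= sub_hom_dim W')%N.
  move=> [F [G [hF hG FG GF]]].
  suff <- : \dim (linfun (postcomp F) @: sub_hom_vspace V')%VS = sub_hom_dim V'.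
    exact/dimvS/postcomp_sub.
  apply: limg_dim_eq; have /eqP-> : lker (linfun (@postcomp U _ _ F)) == 0%VS.
    apply/lker0P/(can_inj (g := postcomp G)) => f.
    by rewrite lfunE /= postcomp_comp; apply: postcomp_id.
  by rewrite capv0.
by move=> VW; apply/eqP; rewrite eqn_leq !leq //; apply: rep_iso_sym.
Qed.

End Dimension.

Lemma ltn_sub_hom_dim U (P P' : hom_subfunctor U) V (F : family U V) :
  (forall G : family U V, P V G -> P' V G) -> P' V F -> ~ P V F ->
  (sub_hom_dim P V < sub_hom_dim P' V)%N.
Proof.
move=> PP' P'F nPF; rewrite ltnNge; apply/negP => le.
have sub : (sub_hom_vspace P V <= sub_hom_vspace P' V)%VS.
  by apply/subvP => f /mem_sub_hom Pf; apply/mem_sub_hom/PP'.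
move: le; rewrite /sub_hom_dim (geq_leqif (dimv_leqif_sup sub)).
move=> /subvP/(_ (of_family F)) SF.
apply: nPF; rewrite -[F]of_familyK; apply/mem_sub_hom/SF/mem_sub_hom.
by rewrite of_familyK.
Qed.

Lemma eq_sub_hom_dim U (P P' : hom_subfunctor U) V :
  (forall F : family U V, P V F <-> P' V F) -> sub_hom_dim P V = sub_hom_dim P' V.
Proof.
move=> PP'; congr (\dim _); apply/eqP; rewrite eqEsubv.
by apply/andP; split; apply/subvP => f /mem_sub_hom/PP' Pf; apply/mem_sub_hom.
Qed.

End HomDimension.

(** * Independence of indecomposables in the representation ring *)

Section Multiplicity.
Variables (K : fieldType) (Q : quiver).
Implicit Types U V W : rep K Q.

Notation family U V := (forall x : vert Q, 'M[K]_(rdim U x, rdim V x)).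

Lemma is_rep_hom0 U V : is_rep_hom ((fun x => 0) : family U V).
Proof. by move=> a; rewrite mulmx0 mul0mx. Qed.

Definition all_homs U : hom_subfunctor U :=
  HomSubfunctor (@is_rep_hom0 U) (@is_rep_hom_lin K Q U) (@is_rep_hom_mul K Q U).

Lemma invertible_endoNzero U (F : family U U) :
  ~ zero_rep U -> invertible_endo F -> ~ forall x, F x = 0.
Proof.
move=> U0 [G _ FG] F0; apply: U0 => x; apply/eqP.
by rewrite -(mxrank1 K (rdim U x)) -FG F0 mul0mx mxrank0.
Qed.

(** * The radical of Hom(U, -) and the multiplicity of U *)

Section Radical.
Variables (U : rep K Q) (indecU : indecomposable U).

Definition radical_hom V (F : family U V) :=
  is_rep_hom F /\ forall G : family V U, is_rep_hom G ->
    ~ invertible_endo (fun x => F x *m G x).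

Lemma radical_hom0 V : radical_hom ((fun x => 0) : family U V).
Proof.
split=> [|G hG inv]; first exact: is_rep_hom0.
by apply: (invertible_endoNzero indecU.1 inv) => x; rewrite mul0mx.
Qed.

(** Closure under sums is where locality of End(U) enters: if [cFH + GH] is invertible, so is one of
    the summands. *)
Lemma radical_hom_lin V c (F G : family U V) :
  radical_hom F -> radical_hom G -> radical_hom (fun x => c *: F x + G x).
Proof.
move=> [hF radF] [hG radG]; split=> [|H hH [L hL FGHL]].
  exact: is_rep_hom_lin.
have hFH := is_rep_hom_mul (is_rep_hom_lin c hF (is_rep_hom0 U V)) hH.
have [|[M hM FHM]|/radG//] :=
    invertible_endo_local indecU hFH (is_rep_hom_mul hG hH).
  by exists L => // x; rewrite -mulmxDl addr0 FGHL.
(* The scalar moves onto the inverse: [cM] inverts [FH]. *)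
have hcM := is_rep_hom_lin c hM (is_rep_hom0 U U).
apply: (radF _ hH); exists (fun x => c *: M x + 0) => // x.
by rewrite addr0 -scalemxAr scalemxAl scalemxAl -[c *: F x]addr0 FHM.
Qed.

Lemma radical_hom_post V W (F : family U V) (H : family V W) :
  radical_hom F -> is_rep_hom H -> radical_hom (fun x => F x *m H x).
Proof.
move=> [hF radF] hH; split=> [|G hG [L hL FHGL]]; first exact: is_rep_hom_mul.
apply: (radF _ (is_rep_hom_mul hH hG)); exists L => // x.
by rewrite mulmxA.
Qed.

Definition radical_homs : hom_subfunctor U :=
  HomSubfunctor radical_hom0 radical_hom_lin radical_hom_post.

(* Up to the factor [dim (End(U) / rad(U, U))], this is the number of
   summands isomorphic to [U] in a decomposition into indecomposables. *)
Definition multiplicity V : int :=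
  (sub_hom_dim (all_homs U) V)%:Z - (sub_hom_dim radical_homs V)%:Z.

Lemma multiplicity_iso V W : rep_iso V W -> multiplicity V = multiplicity W.
Proof. by move=> VW; rewrite /multiplicity !(sub_hom_dim_iso _ VW). Qed.

Lemma multiplicity_dsum V W :
  multiplicity (dsum V W) = multiplicity V + multiplicity W.
Proof. by rewrite /multiplicity !sub_hom_dim_dsum !PoszD opprD addrACA. Qed.

(** The identity of [U] is a morphism outside the radical. *)
Lemma multiplicity_self : multiplicity U != 0.
Proof.
rewrite subr_eq0 eqz_nat gtn_eqF //.
apply: (@ltn_sub_hom_dim _ _ _ _ _ _ (fun x => 1%:M)) => [G []//||/= [_ rad]].
  exact: is_rep_hom1.
apply: (rad _ (@is_rep_hom1 _ _ U)); exists (fun x => 1%:M) => [|x].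
  exact: is_rep_hom1.
by rewrite !mulmx1.
Qed.

(** If [F] from [U] to [V] is not radical, some [G], [L] satisfy [FGL = 1], so [GLF] is an
    idempotent of [V]. If it is 0, then [U] is zero; if it is 1, then [F] is an isomorphism. *)
Lemma multiplicity_noniso V :
  indecomposable V -> ~ rep_iso U V -> multiplicity V = 0.
Proof.
move=> indecV nUV; apply/eqP; rewrite subr_eq0 eqz_nat; apply/eqP.
apply: eq_sub_hom_dim => F; split=> [hF|[]//]; split=> // G hG [L hL FGL].
have hGL := is_rep_hom_mul hG hL.
have [x|P0|P1] := indecomposable_idempotent indecV (is_rep_hom_mul hGL hF).
- by rewrite mulmxA -(mulmxA _ (F x)) (mulmxA (F x)) FGL mulmx1.
- apply: indecU.1 => x; apply/eqP; rewrite -(mxrank1 K (rdim U x)) mxrank_eq0.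
  suff <- : F x *m (G x *m L x *m F x) *m (G x *m L x) = 1%:M.
    by rewrite P0 mulmx0 mul0mx.
  by rewrite !mulmxA FGL mul1mx FGL.
apply: nUV; exists F, (fun x => G x *m L x); split=> // x.
by rewrite mulmxA.
Qed.

End Radical.

Lemma rep_elt_iso V W : rep_iso V W -> rep_elt V = rep_elt W.
Proof. by move=> /iso_classP VW; rewrite /rep_elt /class_elt VW. Qed.

(** Universal property of R(Q) as an abelian group; it makes multiplicities into additive functions
    on R(Q). *)
Lemma rep_ring_lift (m : rep K Q -> int) :
  (forall V W, rep_iso V W -> m V = m W) ->
  (forall V W, m (dsum V W) = m V + m W) ->
  exists h : {additive rep_ring K Q -> int}, forall V, h (rep_elt V) = m V.
Proof.
move=> m_iso m_dsum.
pose f (a : class_group K Q) : int :=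
  @fglift _ int^o _ (fun c : rep_class K Q => m (repr c)) a.
have fB a b : f (a - b) = f a - f b by exact: (@lift_is_additive int _ int^o _ a b).
have f_elt V : f (class_elt V) = m V.
  rewrite /f /class_elt liftU scale1r; apply: m_iso.
  by apply/iso_classP/iso_classK.
have f0 (r : class_group K Q) : rel_subgroup r -> f r = 0.
  (* The kernel of [f] is a subgroup containing the relations. *)
  apply: (@smallest_sub _ _ _ [set r | f r = 0]).
    split=> [|a b /= fa fb]; last by rewrite fB fa fb subrr.
    by exists 0 => /=; rewrite -(subrr 0) fB subrr.
  by move=> _ [V [W ->]] /=; rewrite !fB !f_elt m_dsum addrAC addrK subrr.
have f_repr (a : class_group K Q) : f (repr (\pi_(rep_ring K Q) a)) = f a.
  apply/eqP; rewrite -subr_eq0 -fB; apply/eqP/f0/rep_ring_piP.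
  by rewrite reprK.
pose h (a : rep_ring K Q) := f (repr a).
have hB : zmod_morphism h.
  by elim/quotW=> a; elim/quotW=> b; rewrite -rep_ring_piB /h !f_repr fB.
pose h_add := GRing.isZmodMorphism.Build _ _ h hB.
pose h' : {additive rep_ring K Q -> int} := HB.pack h h_add.
by exists h' => V; rewrite /= /h f_repr.
Qed.

(** The multiplicity of [V i] kills every term of the relation except the one at [i], where its
    value is a nonzero integer times [a i]. *)
Lemma rep_elt_free (I : finType) (V : I -> rep K Q) (a : I -> int) :
  (forall i, indecomposable (V i)) ->
  (forall i j, i <> j -> ~ rep_iso (V i) (V j)) ->
  \sum_i rep_elt (V i) *~ a i = 0 -> forall i, a i = 0.
Proof.
move=> indecV nisoV sum0 i.
have [h hE] := rep_ring_lift (multiplicity_iso (indecV i))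
  (multiplicity_dsum (indecV i)).
have /eqP := congr1 h sum0; rewrite raddf0 raddf_sum (bigD1 i) //= big1.
  rewrite addr0 raddfMz /= hE -mulrzr mulf_eq0 (negPf (multiplicity_self _)) /=.
  by rewrite intz => /eqP.
move=> j /eqP ji; rewrite raddfMz /= hE multiplicity_noniso ?mul0rz //.
exact/nisoV/nesym.
Qed.

End Multiplicity.

(** * Counting morphisms of quivers over Q *)

Lemma inj_surj_bij (S T : Type) (f : S -> T) :
  injective f -> (forall y, exists x, f x = y) -> bijective f.
Proof.
move=> f_inj /choice[g fg]; exists g => // x.
exact/f_inj/fg.
Qed.

Section HomCount.
Variable Q : quiver.
Implicit Types X Y Z W : quiver_over Q.

Lemma over_hom_ext X Y (g h : over_hom X Y) :
  hom_vert (val g) =1 hom_vert (val h) -> hom_arrow (val g) =1 hom_arrow (val h) ->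
  g = h.
Proof. by move=> ev ea; apply/val_inj/quiver_hom_ext. Qed.

Lemma over_vert X Y (g : over_hom X Y) v :
  hom_vert (structure_map Y) (hom_vert (val g) v) = hom_vert (structure_map X) v.
Proof.
have /(congr1 (fun k => hom_vert k v)) := eqP (valP g).
by rewrite !mk_quiver_homE.
Qed.

Lemma over_arrow X Y (g : over_hom X Y) a :
  hom_arrow (structure_map Y) (hom_arrow (val g) a) = hom_arrow (structure_map X) a.
Proof.
have /(congr1 (fun k => hom_arrow k a)) := eqP (valP g).
by rewrite !mk_quiver_homE.
Qed.

(** Existential form, so that later arguments see only the two underlying maps and not the subtype
    proofs. *)
Lemma mk_over_homP X Y (fv : vert X -> vert Y) (fa : arrow X -> arrow Y) :
  (forall a, fv (src a) = src (fa a)) -> (forall a, fv (tgt a) = tgt (fa a)) ->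
  (forall v, hom_vert (structure_map Y) (fv v) = hom_vert (structure_map X) v) ->
  (forall a, hom_arrow (structure_map Y) (fa a) = hom_arrow (structure_map X) a) ->
  exists g : over_hom X Y, hom_vert (val g) =1 fv /\ hom_arrow (val g) =1 fa.
Proof.
move=> hs ht hv ha; have over : quiver_comp (structure_map Y)
    (mk_quiver_hom hs ht) == structure_map X.
  by apply/eqP/quiver_hom_ext => z; rewrite !mk_quiver_homE.
by exists (exist _ (mk_quiver_hom hs ht) over); split=> z; rewrite mk_quiver_homE.
Qed.

Lemma card_over_hom_iso W Y Z :
  over_iso Y Z -> #|{: over_hom W Y}| = #|{: over_hom W Z}|.
Proof.
move=> [g [h [/(congr1 val)/= hg /(congr1 val)/= gh]]].
apply: (bij_eq_card (f := over_comp g)).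
by exists (over_comp h) => f; apply/val_inj;
  rewrite /= quiver_compA ?hg ?gh quiver_comp1q.
Qed.

(** Universal property of the product: composition with the two projections is a bijection onto
    pairs of morphisms. *)
Lemma card_over_hom_fiber W X Y :
  #|{: over_hom W (fiber_product X Y)}|
    = (#|{: over_hom W X}| * #|{: over_hom W Y}|)%N.
Proof.
have [p1 [p1v p1a]] : exists p : over_hom (fiber_product X Y) X,
    hom_vert (val p) =1 (fun u => (val u).1) /\
    hom_arrow (val p) =1 (fun u => (val u).1).
  by apply: mk_over_homP => // z; rewrite mk_quiver_homE.
have [p2 [p2v p2a]] : exists p : over_hom (fiber_product X Y) Y,
    hom_vert (val p) =1 (fun u => (val u).2) /\
    hom_arrow (val p) =1 (fun u => (val u).2).
  (* The structure map of the fiber product is defined through [X]; compatibility with that of [Y]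
     is the equation carried by [z]. *)
  by apply: mk_over_homP => // z; rewrite mk_quiver_homE (eqP (valP z)).
rewrite -card_prod; pose split (f : over_hom W (fiber_product X Y)) :=
  (over_comp p1 f, over_comp p2 f).
apply: (@bij_eq_card _ _ split). apply: inj_surj_bij => [f g|[f1 f2]].
  move=> fg; apply: over_hom_ext => z; apply/val_inj/injective_projections.
  - have := congr1 (fun k => hom_vert (val k.1) z) fg.
    by rewrite !mk_quiver_homE !p1v.
  - have := congr1 (fun k => hom_vert (val k.2) z) fg.
    by rewrite !mk_quiver_homE !p2v.
  - have := congr1 (fun k => hom_arrow (val k.1) z) fg.
    by rewrite !mk_quiver_homE !p1a.
  - have := congr1 (fun k => hom_arrow (val k.2) z) fg.
    by rewrite !mk_quiver_homE !p2a.
have ev v : hom_vert (structure_map X) (hom_vert (val f1) v) ==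
    hom_vert (structure_map Y) (hom_vert (val f2) v) by rewrite !over_vert.
have ea a : hom_arrow (structure_map X) (hom_arrow (val f1) a) ==
    hom_arrow (structure_map Y) (hom_arrow (val f2) a) by rewrite !over_arrow.
have [f [fv fa]] : exists f : over_hom W (fiber_product X Y),
    hom_vert (val f) =1 (fun v => Sub (_, _) (ev v)) /\
    hom_arrow (val f) =1 (fun a => Sub (_, _) (ea a)).
  apply: mk_over_homP => [a|a|v|a];
    rewrite ?mk_quiver_homE /= ?over_vert ?over_arrow //.
    by apply: val_inj; rewrite /= !hom_src.
  by apply: val_inj; rewrite /= !hom_tgt.
exists f; congr (_, _); apply: over_hom_ext => z; rewrite mk_quiver_homE.
- by rewrite p1v fv.
- by rewrite p1a fa.
- by rewrite p2v fv.
- by rewrite p2a fa.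
Qed.

(** * Morphisms into disjoint unions *)

Section Union.
Variables (n : nat) (Y : 'I_n -> quiver_over Q).

Lemma union_inclP i : exists g : over_hom (Y i) (disjoint_union Y),
  hom_vert (val g) =1 Tagged (fun j => vert (Y j)) (i := i) /\
  hom_arrow (val g) =1 Tagged (fun j => arrow (Y j)) (i := i).
Proof. by apply: mk_over_homP => // z; rewrite mk_quiver_homE. Qed.

(** Both ends of an arrow of the union lie in one component, so the tag is constant along adjacent
    vertices. *)
Lemma connected_hom_union W (h : over_hom W (disjoint_union Y)) :
  connected_quiver W -> exists i, forall v, tag (hom_vert (val h) v) = i.
Proof.
move=> [/card_gt0P[v0 _] conn]; exists (tag (hom_vert (val h) v0)) => v.
pose same u := tag (hom_vert (val h) u) == tag (hom_vert (val h) v0).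
have same_closed : closed (@adjacent W) same.
  move=> u w /existsP[a]; rewrite -!topredE /= /same.
  by case/orP=> /andP[/eqP<- /eqP<-]; rewrite hom_src hom_tgt.
have := closed_connect same_closed (conn v0 v).
by rewrite -!topredE /= /same eqxx => /esym/eqP.
Qed.

(** Each morphism factors through exactly one inclusion of a component, so the hom-set is the
    disjoint sum of those into the [Y i]. *)
Lemma card_over_hom_union W : connected_quiver W ->
  #|{: over_hom W (disjoint_union Y)}| = (\sum_i #|{: over_hom W (Y i)}|)%N.
Proof.
move=> connW; have [/card_gt0P[v0 _] _] := connW.
pose incl i := projT1 (cid (union_inclP i)).
have inclE i : hom_vert (val (incl i)) =1 Tagged (fun j => vert (Y j)) (i := i) /\
    hom_arrow (val (incl i)) =1 Tagged (fun j => arrow (Y j)) (i := i).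
  exact: projT2 (cid (union_inclP i)).
transitivity #|{: {i & over_hom W (Y i)}}|; last first.
  by rewrite card_tagged sumnE big_map big_enum.
apply/esym/(bij_eq_card (f := fun g => over_comp (incl (tag g)) (tagged g))).
apply: inj_surj_bij => [[i f] [j g] /= fg|h].
  have fgv v : Tagged (fun j => vert (Y j)) (hom_vert (val f) v) =
      Tagged (fun j => vert (Y j)) (hom_vert (val g) v).
    have := congr1 (fun k => hom_vert (val k) v) fg.
    by rewrite !mk_quiver_homE (inclE i).1 (inclE j).1.
  have fga a : Tagged (fun j => arrow (Y j)) (hom_arrow (val f) a) =
      Tagged (fun j => arrow (Y j)) (hom_arrow (val g) a).
    have := congr1 (fun k => hom_arrow (val k) a) fg.
    by rewrite !mk_quiver_homE (inclE i).2 (inclE j).2.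
  (* The two components agree because [W] has a vertex [v0]; an empty quiver would map into all of
     them. *)
  have /(congr1 tag)/= ij := fgv v0; case: j / ij in g fgv fga {fg} *.
  congr Tagged; apply: over_hom_ext => z.
    exact: eq_from_Tagged (fgv z).
  exact: eq_from_Tagged (fga z).
have [i hi] := connected_hom_union h connW.
have hia a : tag (hom_arrow (val h) a) = i by rewrite -(hi (src a)) hom_src.
have untag (T : 'I_n -> finType) (t : {j & T j}) :
    tag t = i -> exists t' : T i, t = Tagged T t'.
  by case: t => j t /= ij; subst j; exists t.
have /choice[fv fvE] := fun v => untag _ _ (hi v).
have /choice[fa faE] := fun a => untag _ _ (hia a).
have [f [fvf faf]] : exists f : over_hom W (Y i),
    hom_vert (val f) =1 fv /\ hom_arrow (val f) =1 fa.
  apply: mk_over_homP => [a|a|v|a].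
  - by apply: (@eq_from_Tagged _ (fun j => vert (Y j))); rewrite -fvE hom_src faE.
  - by apply: (@eq_from_Tagged _ (fun j => vert (Y j))); rewrite -fvE hom_tgt faE.
  - by rewrite -(over_vert h) fvE mk_quiver_homE.
  - by rewrite -(over_arrow h) faE mk_quiver_homE.
exists (Tagged (fun i => over_hom W (Y i)) f).
apply: over_hom_ext => z; rewrite mk_quiver_homE.
  by rewrite (inclE i).1 fvf fvE.
by rewrite (inclE i).2 faf faE.
Qed.

End Union.

End HomCount.

(** * Linearizations *)

Section LinearBasis.
Variables (K : fieldType) (Q : quiver).
Implicit Types (X Y : quiver_over Q) (V W : rep K Q).

Definition arrows_between X (a : arrow Q) (u v : vert X) : {set arrow X} :=
  [set b | [&& hom_arrow (structure_map X) b == a, src b == u & tgt b == v]].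

(* [V] is the linearization of [X], but for the order of the basis vectors. *)
Definition has_basis V X := exists c : forall x, 'I_(rdim V x) -> vert X,
  [/\ forall x, injective (c x),
      forall x v, (exists i, c x i = v) <-> hom_vert (structure_map X) v = x
    & forall a i j, rmap V a i j = #|arrows_between a (c _ i) (c _ j)|%:R].

Lemma linearization_basis X : has_basis (linearization K X) X.
Proof.
exists (fun x => @enum_val _ (@fiber_at Q X x)); split=> [x|x v|a i j].
- exact: enum_val_inj.
- split=> [[i <-]|vx]; first by apply/eqP/(enum_valP i).
  have Fv : v \in @fiber_at Q X x by apply/eqP.
  by exists (enum_rank_in Fv v); rewrite enum_rankK_in.
rewrite summxE -sum1_card natr_sum big_mkcond [RHS]big_mkcond /=.
apply: eq_bigr => b _; rewrite inE mxE.
rewrite [src b == _]eq_sym [tgt b == _]eq_sym.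
by case: eqP => //= _; case: andP.
Qed.

(** Both bases at [x] enumerate the fiber over [x], so matching them reorders one into the other. *)
Lemma has_basis_iso V W X : has_basis V X -> has_basis W X -> rep_iso V W.
Proof.
move=> [c [c_inj cP cE]] [d [d_inj dP dE]].
have /all_sig[e eE] x :
    {e : 'I_(rdim V x) -> 'I_(rdim W x) | forall i, d x (e i) = c x i}.
  suff /choice[e eE] : forall i, exists j, d x j = c x i by exists e.
  by move=> i; apply/dP/cP; exists i.
have /all_sig[e' e'E] x :
    {e : 'I_(rdim W x) -> 'I_(rdim V x) | forall i, c x (e i) = d x i}.
  suff /choice[e' e'E] : forall i, exists j, c x j = d x i by exists e'.
  by move=> i; apply/cP/dP; exists i.
apply: (@rep_iso_reindex _ _ V W e e') => [x i|x i|a i j].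
- by apply: c_inj; rewrite e'E eE.
- by apply: d_inj; rewrite eE e'E.
by rewrite cE dE !eE.
Qed.

Lemma has_basis_over_iso V X Y : over_iso X Y -> has_basis V X -> has_basis V Y.
Proof.
move=> [g [h [hg gh]]] [c [c_inj cP cE]].
have hgv v : hom_vert (val h) (hom_vert (val g) v) = v.
  by have := congr1 (fun k => hom_vert (val k) v) hg; rewrite !mk_quiver_homE.
have ghv v : hom_vert (val g) (hom_vert (val h) v) = v.
  by have := congr1 (fun k => hom_vert (val k) v) gh; rewrite !mk_quiver_homE.
have hga a : hom_arrow (val h) (hom_arrow (val g) a) = a.
  by have := congr1 (fun k => hom_arrow (val k) a) hg; rewrite !mk_quiver_homE.
have gha a : hom_arrow (val g) (hom_arrow (val h) a) = a.
  by have := congr1 (fun k => hom_arrow (val k) a) gh; rewrite !mk_quiver_homE.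
exists (fun x i => hom_vert (val g) (c x i)); split=> [x|x v|a i j].
- exact: inj_comp (can_inj hgv) (c_inj x).
- rewrite -(over_vert h) -cP; split=> -[i E]; exists i; last by rewrite E ghv.
  by rewrite -E hgv.
rewrite cE -(card_imset _ (can_inj hga)); congr (#|pred_of_set _|%:R).
apply/setP => b; rewrite !inE; apply/imsetP/idP => [[b']|].
  rewrite inE => /and3P[/eqP ab /eqP sb /eqP tb] ->.
  by rewrite over_arrow ab -!hom_src -!hom_tgt sb tb !eqxx.
move=> /and3P[/eqP ab /eqP sb /eqP tb]; exists (hom_arrow (val h) b) => //.
by rewrite inE over_arrow -hom_src -hom_tgt ab sb tb !hgv !eqxx.
Qed.

(** The tensor of two basis vectors corresponds to a pair of vertices. Arrows between pairs are
    pairs of arrows, so the counts multiply as in the Kronecker product. *)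
Lemma has_basis_tens V W X Y :
  has_basis V X -> has_basis W Y -> has_basis (tens V W) (fiber_product X Y).
Proof.
move=> [c [c_inj cP cE]] [d [d_inj dP dE]].
have e_subproof x (k : 'I_(rdim V x * rdim W x)) :
    hom_vert (structure_map X) (c x (mxtens_unindex k).1) ==
    hom_vert (structure_map Y) (d x (mxtens_unindex k).2).
  rewrite (iffLR (cP x _)); last by eexists.
  by rewrite (iffLR (dP x _)) //; eexists.
pose e x (k : 'I_(rdim V x * rdim W x)) : vert (fiber_product X Y) :=
  exist _ (_, _) (e_subproof x k).
have eE x i j : val (e x (mxtens_index (i, j))) = (c x i, d x j).
  rewrite -[LHS]/(c x (mxtens_unindex _).1, d x (mxtens_unindex _).2).
  by rewrite mxtens_indexK.
exists e; split=> [x|x u|a k l].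
- move=> k l; case: (mxtens_indexP k) => i i'; case: (mxtens_indexP l) => j j'.
  by move=> /(congr1 val); rewrite !eE => -[/c_inj-> /d_inj->].
- rewrite mk_quiver_homE; split=> [[k <-]|ux]; first by apply/cP; eexists.
  have /cP[i ci] := ux; have /dP[j dj] := etrans (esym (eqP (valP u))) ux.
  exists (mxtens_index (i, j)); apply: val_inj; rewrite eE ci dj.
  exact/esym/surjective_pairing.
case: (mxtens_indexP k) => i i'; case: (mxtens_indexP l) => j j'.
rewrite tensmxE cE dE -natrM -cardsX -[in RHS](card_imset _ val_inj).
congr (#|pred_of_set _|%:R); apply/setP => -[b b'].
apply/setXP/imsetP; rewrite !inE /=.
  move=> [/and3P[/eqP ab /eqP sb /eqP tb] /and3P[/eqP ab' /eqP sb' /eqP tb']].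
  have bb' : hom_arrow (structure_map X) b == hom_arrow (structure_map Y) b'.
    by rewrite ab ab'.
  exists (exist _ (b, b') bb') => //; rewrite inE mk_quiver_homE /= ab eqxx /=.
  by apply/andP; split; apply/eqP/val_inj; rewrite eE /= ?sb ?sb' ?tb ?tb'.
move=> [[[b1 b1'] /= bb']]; rewrite inE mk_quiver_homE /=.
move=> /and3P[/eqP ab /eqP/(congr1 val) + /eqP/(congr1 val)].
rewrite !eE /= => -[sb sb'] [tb tb'] [-> ->].
by rewrite sb tb sb' tb' -(eqP bb') ab !eqxx.
Qed.

(** The hypotheses say that [Z] is the disjoint union of [X] and [Y] along [f] and [g]. No arrow
    joins the two parts, whence the zero off-diagonal blocks. *)
Lemma has_basis_dsum V W X Y Z (f : over_hom X Z) (g : over_hom Y Z) :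
  injective (hom_vert (val f)) -> injective (hom_vert (val g)) ->
  injective (hom_arrow (val f)) -> injective (hom_arrow (val g)) ->
  (forall x y, hom_vert (val f) x <> hom_vert (val g) y) ->
  (forall z, (exists x, hom_vert (val f) x = z) \/
    (exists y, hom_vert (val g) y = z)) ->
  (forall z, (exists x, hom_arrow (val f) x = z) \/
    (exists y, hom_arrow (val g) y = z)) ->
  has_basis V X -> has_basis W Y -> has_basis (dsum V W) Z.
Proof.
move=> fv_inj gv_inj fa_inj ga_inj fNg fgv fga [c [c_inj cP cE]] [d [d_inj dP dE]].
have sub_f a u v : arrows_between a (hom_vert (val f) u) (hom_vert (val f) v) =
    hom_arrow (val f) @: arrows_between a u v.
  apply/setP => b; rewrite !inE; apply/idP/imsetP => [|[b']].
    have [[b' <-]|[b' <-]] := fga b; last first.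
      by rewrite -!hom_src -!hom_tgt => /and3P[_ /eqP/esym/fNg].
    rewrite over_arrow -!hom_src -!hom_tgt !(inj_eq fv_inj) => ab'.
    by exists b'; rewrite ?inE.
  by rewrite inE => ab' ->; rewrite over_arrow -!hom_src -!hom_tgt !(inj_eq fv_inj).
have sub_g a u v : arrows_between a (hom_vert (val g) u) (hom_vert (val g) v) =
    hom_arrow (val g) @: arrows_between a u v.
  apply/setP => b; rewrite !inE; apply/idP/imsetP => [|[b']].
    have [[b' <-]|[b' <-]] := fga b.
      by rewrite -!hom_src -!hom_tgt => /and3P[_ /eqP/fNg].
    rewrite over_arrow -!hom_src -!hom_tgt !(inj_eq gv_inj) => ab'.
    by exists b'; rewrite ?inE.
  by rewrite inE => ab' ->; rewrite over_arrow -!hom_src -!hom_tgt !(inj_eq gv_inj).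
have sub_fg a u v :
    arrows_between a (hom_vert (val f) u) (hom_vert (val g) v) = finset.set0.
  apply/setP => b; rewrite !inE; apply/negP => /and3P[_].
  have [[b' <-]|[b' <-]] := fga b; rewrite -!hom_src -!hom_tgt.
    by move=> _ /eqP/fNg.
  by move=> /eqP/esym/fNg.
have sub_gf a u v :
    arrows_between a (hom_vert (val g) u) (hom_vert (val f) v) = finset.set0.
  apply/setP => b; rewrite !inE; apply/negP => /and3P[_].
  have [[b' <-]|[b' <-]] := fga b; rewrite -!hom_src -!hom_tgt.
    by move=> /eqP/fNg.
  by move=> _ /eqP/esym/fNg.
pose e x (k : 'I_(rdim V x + rdim W x)) := match split k with
  | inl i => hom_vert (val f) (c x i)
  | inr j => hom_vert (val g) (d x j)
  end.
have eL x i : e x (lshift _ i) = hom_vert (val f) (c x i).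
  by rewrite /e (unsplitK (inl i)).
have eR x j : e x (rshift _ j) = hom_vert (val g) (d x j).
  by rewrite /e (unsplitK (inr j)).
exists e; split=> [x|x z|a k l].
- move=> k l; rewrite -(splitK k) -(splitK l).
  case: (split k) => i; case: (split l) => j /=; rewrite ?(eL, eR).
  + by move=> /fv_inj/c_inj->.
  + by move=> /fNg.
  + by move=> /esym/fNg.
  + by move=> /gv_inj/d_inj->.
- split=> [[k <-]|].
    rewrite -(splitK k); case: (split k) => i /=; rewrite (eL, eR) over_vert.
      by apply/cP; exists i.
    by apply/dP; exists i.
  have [[v <-]|[v <-]] := fgv z; rewrite over_vert.
    by move=> /cP[i <-]; exists (lshift _ i).
  by move=> /dP[i <-]; exists (rshift _ i).
rewrite -(splitK k) -(splitK l).
case: (split k) => i; case: (split l) => j /=; rewrite ?(eL, eR).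
- by rewrite block_mxEul sub_f card_imset.
- by rewrite block_mxEur sub_fg cards0 mxE.
- by rewrite block_mxEdl sub_gf cards0 mxE.
- by rewrite block_mxEdr sub_g card_imset.
Qed.

Lemma has_basis_union n (Y : 'I_n.+1 -> quiver_over Q) V W :
  has_basis V (Y ord0) ->
  has_basis W (disjoint_union (fun i : 'I_n => Y (fintype.lift ord0 i))) ->
  has_basis (dsum V W) (disjoint_union Y).
Proof.
have [f [fv fa]] := union_inclP Y ord0.
pose Y' i := Y (fintype.lift ord0 i).
have [g [gv ga]] : exists g : over_hom (disjoint_union Y') (disjoint_union Y),
    hom_vert (val g) =1 (fun u => Tagged (fun j => vert (Y j)) (tagged u)) /\
    hom_arrow (val g) =1 (fun u => Tagged (fun j => arrow (Y j)) (tagged u)).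
  by apply: mk_over_homP => // z; rewrite !mk_quiver_homE.
(* These facts are stated for arbitrary [T] to serve for both vertices and arrows. *)
have inj0 (T : 'I_n.+1 -> Type) : injective (Tagged T (i := ord0)).
  by move=> t t' E; apply: eq_from_Tagged E.
have injS (T : 'I_n.+1 -> Type) :
    injective (fun u : {i : 'I_n & T (fintype.lift ord0 i)} => Tagged T (tagged u)).
  move=> [i t] [j t'] /= E; have /lift_inj ij := congr1 tag E; subst j.
  by rewrite (eq_from_Tagged E).
have surj (T : 'I_n.+1 -> Type) (z : {i & T i}) :
    (exists t, Tagged T (i := ord0) t = z) \/
    (exists u : {i : 'I_n & T (fintype.lift ord0 i)}, Tagged T (tagged u) = z).
  case: z => i t; case: (unliftP ord0 i) => [j|] ij; subst i; last by left; exists t.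
  by right; exists (Tagged (fun j => T (fintype.lift ord0 j)) t).
apply: (@has_basis_dsum _ _ _ _ _ f g) => [u v|u v|u v|u v|u v|z|z].
- by rewrite !fv; apply: inj0.
- by rewrite !gv; apply: injS.
- by rewrite !fa; apply: inj0.
- by rewrite !ga; apply: injS.
- by rewrite fv gv => /(congr1 tag).
- have [[t <-]|[t <-]] := surj _ z; [left|right]; exists t; [exact: fv|exact: gv].
- have [[t <-]|[t <-]] := surj _ z; [left|right]; exists t; [exact: fa|exact: ga].
Qed.

End LinearBasis.

(** * Classes of linearizations in R(Q) *)

Section LinearizationRing.
Variables (K : fieldType) (Q : quiver).

(** For zero [V] the sum of [V] with itself is isomorphic to [V], so its class [c] satisfies
    [c + c = c]. *)
Lemma rep_elt_zero (V : rep K Q) : zero_rep V -> rep_elt V = 0.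
Proof.
move=> V0; apply: (addrI (rep_elt V)); rewrite addr0 -rep_elt_dsum.
apply: rep_elt_iso; apply: (@rep_iso_reindex _ _ (dsum V V) V
  (fun x k => match split k with inl i => i | inr i => i end)
  (fun x i => lshift _ i)).
all: by move=> x [i iV]; exfalso; move: iV; rewrite /= !V0.
Qed.

Lemma rep_elt_fiber_product (X Y : quiver_over Q) :
  rep_elt (linearization K (fiber_product X Y)) =
  rep_elt (linearization K X) * rep_elt (linearization K Y).
Proof.
rewrite -rep_elt_tens; apply/rep_elt_iso/has_basis_iso.
  exact: linearization_basis.
by apply: has_basis_tens; apply: linearization_basis.
Qed.

Lemma rep_elt_disjoint_union n (Y : 'I_n -> quiver_over Q) :
  rep_elt (linearization K (disjoint_union Y)) =
  \sum_i rep_elt (linearization K (Y i)).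
Proof.
elim: n Y => [|n IHn] Y.
  (* The empty union linearizes to the zero representation. *)
  rewrite big_ord0; apply: rep_elt_zero => x; apply: eq_card0 => -[[]//].
rewrite big_ord_recl -IHn -rep_elt_dsum; apply/rep_elt_iso/has_basis_iso.
  exact: linearization_basis.
by apply: has_basis_union; apply: linearization_basis.
Qed.

Lemma rep_elt_over_iso (X Y : quiver_over Q) : over_iso X Y ->
  rep_elt (linearization K X) = rep_elt (linearization K Y).
Proof.
move=> XY; apply/rep_elt_iso/has_basis_iso; last exact: linearization_basis.
by apply: has_basis_over_iso XY _; apply: linearization_basis.
Qed.

End LinearizationRing.

(** * The isomorphism *)

Section SumsOfLinearizations.
Variables (K : fieldType) (Q : quiver) (C : acyclicCat) (L : C -> rep K Q).

Definition lin_sum (a : mobius_ring C) : rep_ring K Q :=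
  \sum_x rep_elt (L x) *~ a x.

Lemma lin_sum_is_additive : zmod_morphism lin_sum.
Proof.
move=> a b; rewrite -sumrB; apply: eq_bigr => x _.
by rewrite !ffunE mulrzBr.
Qed.

HB.instance Definition _ :=
  GRing.isZmodMorphism.Build (mobius_ring C) (rep_ring K Q) lin_sum
    lin_sum_is_additive.

Lemma lin_sum_basis x : lin_sum (mobius_basis x) = rep_elt (L x).
Proof.
rewrite /lin_sum (bigD1 x) //= ffunE eqxx mulr1z big1 ?addr0 // => y yx.
by rewrite ffunE (negPf yx) mulr0z.
Qed.

Lemma lin_sum_mul :
  (forall x y, lin_sum (mobius_basis x * mobius_basis y) =
    rep_elt (L x) * rep_elt (L y)) ->
  {morph lin_sum : a b / a * b}.
Proof.
move=> mul_basis a b.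
rewrite [a in LHS]mobius_basisE [b in LHS]mobius_basisE mulr_suml raddf_sum.
rewrite [lin_sum a in RHS]/lin_sum mulr_suml; apply: eq_bigr => x _.
rewrite mulr_sumr raddf_sum /lin_sum mulr_sumr; apply: eq_bigr => y _.
by rewrite mulrzAl mulrzAr !raddfMz /= mul_basis mulrzAl mulrzAr.
Qed.

End SumsOfLinearizations.

Lemma mobius_basis_mul (C : acyclicCat) (x y : C) n (z : 'I_n -> C) :
  (forall w, #|mor w x| * #|mor w y| = \sum_i #|mor w (z i)|)%N ->
  mobius_basis x * mobius_basis y = \sum_i mobius_basis (z i).
Proof.
move=> hom_xy; apply: mobius_coord_inj => w.
rewrite mobius_coord_mul raddf_sum !mobius_coord_basis /hom_count -PoszM hom_xy.
rewrite -natz natr_sum; apply: eq_bigr => i _.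
by rewrite /= mobius_coord_basis natz.
Qed.

Lemma subring_sum (R : pzRingType) (S : set R) (I : Type) (r : seq I) (f : I -> R)
    (m : I -> int) :
  is_subring S -> (forall i, S (f i)) -> S (\sum_(i <- r) f i *~ m i).
Proof.
move=> [[s Ss] SB _] Sf.
(* A subring need not contain 1, so 0 is obtained as a difference. *)
have S0 : S 0 by rewrite -(subrr s); apply: SB.
have SN a : S a -> S (- a) by rewrite -sub0r; apply: SB.
have SD a b : S a -> S b -> S (a + b).
  by move=> Sa /SN; rewrite -{2}[b]opprK; apply: SB.
have SMn a k : S a -> S (a *+ k).
  by move=> Sa; elim: k => // k; rewrite mulrS; apply: SD.
apply: (big_ind S) => // i _; case: (m i) => k; first exact: SMn.
by rewrite NegzE mulrNz; apply/SN/SMn.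
Qed.

Theorem theorem9 (K : fieldType) (Q : quiver)
  (I : finType) (X : I -> quiver_over Q)
  (acycX : acyclic (full_subcat X))
  (connX : forall x : I, connected_quiver (X x))
  (wrapX : forall x : I, wrapping (structure_map (X x)))
  (fiberX : closed_under_fiber_products X)
  (indecX : forall x : I, indecomposable (linearization K (X x)))
  (nisoX : forall x y : I, x <> y ->
    ~ rep_iso (linearization K (X x)) (linearization K (X y))) :
  isomorphic_to_subring (mobius_ring (AcyclicCat acycX))
    (generated_subring
      [set rep_elt (linearization K (X x)) | x in [set: I]]%classic).
Proof.
pose C := AcyclicCat acycX; pose L (x : C) := linearization K (X x).
have phiM : {morph lin_sum L : a b / a * b}.
  apply: lin_sum_mul => x y; have [n [z xy]] := fiberX x y.
  rewrite (@mobius_basis_mul C x y n z) => [|w].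
    rewrite raddf_sum -rep_elt_fiber_product (rep_elt_over_iso K xy).
    rewrite rep_elt_disjoint_union; apply: eq_bigr => i _.
    exact: (lin_sum_basis L).
  (* [[w,x][w,y]] counts the morphisms from [w] to the fiber product, hence to the disjoint union of
     the [z i]. *)
  rewrite -card_over_hom_fiber (card_over_hom_iso _ xy).
  exact: card_over_hom_union.
exists (lin_sum L); split=> //; first exact: raddfD.
  apply: raddf_inj => a /(rep_elt_free indecX nisoX) a0.
  by apply/ffunP => x; rewrite a0 ffunE.
apply/seteqP; split=> [_ [a _ <-]|].
  (* The image lies in every subring [S] containing the generators; conversely, it is itself such a
     subring. *)
  move=> S [subS genS]; apply: subring_sum => // x.
  by apply: genS; exists x.
apply: smallest_sub => [|_ [x _ <-]]; last first.
  by exists (mobius_basis (x : C)) => //; apply: (lin_sum_basis L).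
split=> [|_ _ [a _ <-] [b _ <-]|_ _ [a _ <-] [b _ <-]].
- by exists (lin_sum L 0), 0.
- by exists (a - b) => //; apply: raddfB.
- by exists (a * b) => //; apply: phiM.
Qed.
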